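(* Let $\Lambda$ be a row-finite $k$-graph without sources and $\mathsf{k}$ any field. Let $\mathcal{A}$ be the $\mathbb{Z}^k$-order ideal of $T_\Lambda$ generated by all the aperiodic atoms in $T_\Lambda$. Then the following hold. (i) For $v\in\Lambda^0$, $\mathrm{KP}_{\mathsf{k}}(\Lambda)p_v$ is a minimal left ideal of $\mathrm{KP}_{\mathsf{k}}(\Lambda)$ if and only if $v=v(0)$ is an aperiodic atom in $T_\Lambda$. (ii) $\mathrm{Soc}(\mathrm{KP}_{\mathsf{k}}(\Lambda))=I(H_{\mathcal{A}})$, where $H_{\mathcal{A}}=\{v\in\Lambda^0: v(0)\in\mathcal{A}\}$ (a hereditary saturated subset of $\Lambda^0$) and $I(H_{\mathcal{A}})$ is the ideal of $\mathrm{KP}_{\mathsf{k}}(\Lambda)$ generated by $H_{\mathcal{A}}$, i.e. by $\{p_v: v\in H_{\mathcal{A}}\}$. (iii) $\mathrm{Soc}(\mathrm{KP}_{\mathsf{k}}(\Lambda))$ is an essential ideal of $\mathrm{KP}_{\mathsf{k}}(\Lambda)$ if and only if for each $v\in\Lambda^0$ there exist $w\in\Lambda^0$ and $m\in\mathbb{N}^k$ such that $v(0)\ge w(m)$ and $w(m)$ is an aperiodic atom in $T_\Lambda$.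
   Context: **$k$-graphs.** $\mathbb{N}=\{0,1,2,\dots\}$, $k\ge 1$, $e_i$ is the $i$-th standard generator of $\mathbb{N}^k$. A $k$-graph is a countable small category $\Lambda$ with object set $\Lambda^0$ (identified with the identity morphisms), range and source maps $r,s:\Lambda\to\Lambda^0$, and a functor $d:\Lambda\to\mathbb{N}^k$ with the unique factorization property: if $d(\lambda)=m+n$ there are unique $\mu_1,\mu_2\in\Lambda$ with $\lambda=\mu_1\mu_2$, $d(\mu_1)=m$, $d(\mu_2)=n$ (the product $\mu_1\mu_2$ is defined iff $s(\mu_1)=r(\mu_2)$). $v\Lambda^n=\{\lambda: r(\lambda)=v, d(\lambda)=n\}$. $\Lambda$ is row-finite if every $v\Lambda^n$ is finite, and has no sources if every $v\Lambda^n$ is nonempty. $H\subseteq\Lambda^0$ is hereditary if $r(\lambda)\in H$ implies $s(\lambda)\in H$; saturated if $s(v\Lambda^n)\subseteq H$ (for some $n\in\mathbb{N}^k$) implies $v\in H$. **Talented monoid.** $T_\Lambda$ is the commutative monoid generated by symbols $v(n)$ ($v\in\Lambda^0$, $n\in\mathbb{Z}^k$) subject to $v(n)=\sum_{\alpha\in v\Lambda^{e_i}}s(\alpha)(n+e_i)$ for all $v$, $n$ and $i\in\{1,\dots,k\}$ with $v\Lambda^{e_i}\neq\emptyset$. $\mathbb{Z}^k$ acts on it by monoid automorphisms determined by ${}^{n}v(m)=v(m+n)$. Put $x\le y$ iff $y=x+z$ for some $z$. A $\mathbb{Z}^k$-order ideal is a submonoid $J$ closed under the action such that $x\le y\in J$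 implies $x\in J$. A unit is an element $u\le 0$; a nonunit $a$ is an atom if $a=b+c$ implies $b$ or $c$ is a unit. A nonzero $a$ is periodic if ${}^{n}a=a$ for some $0\ne n\in\mathbb{Z}^k$, otherwise aperiodic. **Kumjian–Pask algebra.** Let $\Lambda^{\neq0}=\{\lambda: d(\lambda)\ne 0\}$. $\mathrm{KP}_{\mathsf{k}}(\Lambda)$ is the universal $\mathsf{k}$-algebra generated by elements $p_v$ ($v\in\Lambda^0$), $s_\lambda,s_{\lambda^*}$ ($\lambda\in\Lambda^{\neq 0}$) subject to: (KP1) $p_up_v=\delta_{u,v}p_u$; (KP2) $s_\lambda s_\mu=s_{\lambda\mu}$, $s_{\mu^*}s_{\lambda^*}=s_{(\lambda\mu)^*}$ when $s(\lambda)=r(\mu)$, and $p_{r(\lambda)}s_\lambda=s_\lambda=s_\lambda p_{s(\lambda)}$, $p_{s(\lambda)}s_{\lambda^*}=s_{\lambda^*}=s_{\lambda^*}p_{r(\lambda)}$; (KP3) $s_{\lambda^*}s_\mu=\delta_{\lambda,\mu}p_{s(\lambda)}$ when $d(\lambda)=d(\mu)$; (KP4) $p_v=\sum_{\lambda\in v\Lambda^n}s_\lambda s_{\lambda^*}$ for all $v\in\Lambda^0$, $n\in\mathbb{N}^k$ (with $s_v=s_{v^*}=p_v$ for $v\in\Lambda^0$). $\mathrm{Soc}(A)$ is the sum of all minimal left ideals of $A$. A two-sided ideal is essential if it has nonzero intersection with every nonzero two-sided ideal. *)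

(* Defs.v *)
From HB Require Import structures.
From mathcomp Require Import all_boot all_order all_algebra.
From mathcomp Require Import finmap boolp classical_sets cardinality.

Set Implicit Arguments.
Unset Strict Implicit.
Unset Printing Implicit Defensive.

Import GRing.Theory.
Local Open Scope classical_set_scope.
Local Open Scope ring_scope.
Local Open Scope quotient_scope.

(* [comp] is total, but its values are constrained (and used) only on
   composable pairs, i.e. when [src l = rng m]. *)
Record kgraph (k : nat) := KGraph {
  vtx : countType;
  mor :> countType;
  rng : mor -> vtx;
  src : mor -> vtx;
  idm : vtx -> mor;
  comp : mor -> mor -> mor;
  deg : mor -> 'rV[nat]_k;
  rng_idm : forall v, rng (idm v) = v;
  src_idm : forall v, src (idm v) = v;
  rng_comp : forall l m, src l = rng m -> rng (comp l m) = rng l;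
  src_comp : forall l m, src l = rng m -> src (comp l m) = src m;
  comp_idl : forall l, comp (idm (rng l)) l = l;
  comp_idr : forall l, comp l (idm (src l)) = l;
  compA : forall l m n, src l = rng m -> src m = rng n ->
    comp l (comp m n) = comp (comp l m) n;
  deg_idm : forall v, deg (idm v) = 0;
  deg_comp : forall l m, src l = rng m -> deg (comp l m) = deg l + deg m;
  factorization : forall l m n, deg l = m + n ->
    exists! p : mor * mor,
      [/\ src p.1 = rng p.2, comp p.1 p.2 = l, deg p.1 = m & deg p.2 = n]
}.

Section KGraphTheory.
Variables (k : nat) (L : kgraph k).

(* the set $v\Lambda^n$ *)
Definition paths (v : vtx L) (n : 'rV[nat]_k) : set L :=
  [set l | rng l = v /\ deg l = n].

Definition row_finite : Prop := forall v n, finite_set (paths v n).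

Definition no_sources : Prop := forall v n, paths v n !=set0.

Definition hereditary (H : set (vtx L)) : Prop :=
  forall l : L, H (rng l) -> H (src l).

Definition saturated (H : set (vtx L)) : Prop :=
  forall v n, @src k L @` paths v n `<=` H -> H v.

End KGraphTheory.

Arguments paths {k} L v n.

Section Monoid.
Variable M : nmodType.

Definition alg_le (x y : M) : Prop := exists z, y = x + z.

Definition is_unit (u : M) : Prop := alg_le u 0.

Definition atom (a : M) : Prop :=
  ~ is_unit a /\ forall b c, a = b + c -> is_unit b \/ is_unit c.

End Monoid.

Section Talented.
Variables (k : nat) (L : kgraph k).

(* The pair (v, n) stands for the symbol v(n), and a list of pairs for the sum
   of its entries in the free commutative monoid. *)
Definition tal_word := seq (vtx L * 'rV[int]_k).

HB.instance Definition _ := Choice.on tal_word.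

Definition tal_step (v : vtx L) (n : 'rV[int]_k) (i : 'I_k) : tal_word :=
  [seq (src a, n + delta_mx 0 i) | a <- fset_set (paths L v (delta_mx 0 i))].

(* The congruence presenting the talented monoid. The enumeration of
   [paths L v (delta_mx 0 i)] in [tal_step] is meaningful when that set is
   finite, i.e. for row-finite graphs. *)
Inductive tal_eqv : tal_word -> tal_word -> Prop :=
| tal_perm x y : perm_eq x y -> tal_eqv x y
| tal_rel v n i : paths L v (delta_mx 0 i) !=set0 ->
    tal_eqv [:: (v, n)] (tal_step v n i)
| tal_cat x x' y y' : tal_eqv x x' -> tal_eqv y y' ->
    tal_eqv (x ++ y) (x' ++ y')
| tal_sym x y : tal_eqv x y -> tal_eqv y x
| tal_trans x y z : tal_eqv x y -> tal_eqv y z -> tal_eqv x z.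

Definition tal_rel_bool (x y : tal_word) : bool := `[< tal_eqv x y >].

Lemma tal_rel_bool_equiv : equiv_class_of tal_rel_bool.
Proof.
split=> [x|x y|y x z].
- by apply/asboolP; apply: tal_perm.
- by apply/asboolP/asboolP; apply: tal_sym.
- by move=> /asboolP xy /asboolP yz; apply/asboolP; apply: tal_trans yz.
Qed.

Canonical tal_equiv := EquivRelPack tal_rel_bool_equiv.

Definition talented := {eq_quot tal_equiv}.

HB.instance Definition _ := Choice.on talented.
HB.instance Definition _ := EqQuotient.on talented.

Definition tal_pi (x : tal_word) : talented := \pi_talented x.

Lemma tal_piP x y : tal_pi x = tal_pi y <-> tal_eqv x y.
Proof.
by split=> [/eqmodP/asboolP//|h]; apply/eqmodP/asboolP.
Qed.

Lemma tal_reprK x : tal_pi (repr x) = x.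
Proof. exact: reprK. Qed.

Lemma tal_piW (P : talented -> Prop) : (forall x, P (tal_pi x)) -> forall x, P x.
Proof. by move=> h x; rewrite -(tal_reprK x). Qed.

Definition tal_add (x y : talented) : talented := tal_pi (repr x ++ repr y).

Lemma tal_pi_cat x y : tal_add (tal_pi x) (tal_pi y) = tal_pi (x ++ y).
Proof. by apply/tal_piP; apply: tal_cat; apply/tal_piP; rewrite tal_reprK. Qed.

Lemma tal_addA : associative tal_add.
Proof.
elim/tal_piW=> x; elim/tal_piW=> y; elim/tal_piW=> z.
by rewrite !tal_pi_cat catA.
Qed.

Lemma tal_addC : commutative tal_add.
Proof.
elim/tal_piW=> x; elim/tal_piW=> y; rewrite !tal_pi_cat.
by apply/tal_piP/tal_perm; rewrite perm_catC.
Qed.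

Lemma tal_add0 : left_id (tal_pi [::]) tal_add.
Proof. by elim/tal_piW=> x; rewrite tal_pi_cat. Qed.

HB.instance Definition _ :=
  GRing.isNmodule.Build talented tal_addA tal_addC tal_add0.

Definition tal_gen (v : vtx L) (n : 'rV[int]_k) : talented :=
  tal_pi [:: (v, n)].

Lemma tal_genE (v : vtx L) n i :
  paths L v (delta_mx 0 i) !=set0 ->
  tal_gen v n =
  \sum_(a <- fset_set (paths L v (delta_mx 0 i)))
     tal_gen (src a) (n + delta_mx 0 i).
Proof.
move=> ne; have -> : tal_gen v n = tal_pi (tal_step v n i).
  by apply/tal_piP/tal_rel.
rewrite /tal_step; elim: (enum_fset _) => [|a s IHs]; first by rewrite big_nil.
by rewrite big_cons -IHs /= -[LHS]/(tal_pi ([:: _] ++ _)) -tal_pi_cat.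
Qed.

Definition word_shift (n : 'rV[int]_k) (x : tal_word) : tal_word :=
  [seq (g.1, g.2 + n) | g <- x].

Definition tal_shift (n : 'rV[int]_k) (x : talented) : talented :=
  tal_pi (word_shift n (repr x)).

Lemma word_shift_eqv n x y :
  tal_eqv x y -> tal_eqv (word_shift n x) (word_shift n y).
Proof.
elim=> {x y} [x y xy|v m i ne|x x' y y' _ hx _ hy|x y _|x y z _ hx _].
- exact/tal_perm/perm_map.
- suff -> : word_shift n (tal_step v m i) = tal_step v (m + n) i.
    exact: tal_rel.
  rewrite /word_shift /tal_step -map_comp.
  by apply: eq_map => a /=; rewrite addrAC.
- by rewrite /word_shift !map_cat; apply: tal_cat.
- exact: tal_sym.
- exact: tal_trans.
Qed.

Lemma tal_shift_pi n x : tal_shift n (tal_pi x) = tal_pi (word_shift n x).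
Proof. by apply/tal_piP/word_shift_eqv/tal_piP; rewrite tal_reprK. Qed.

Lemma tal_shift_gen n v m : tal_shift n (tal_gen v m) = tal_gen v (m + n).
Proof. exact: tal_shift_pi. Qed.

Lemma tal_shift_is_nmod_morphism n : nmod_morphism (tal_shift n).
Proof.
split; first exact: (tal_shift_pi n [::]).
elim/tal_piW=> x; elim/tal_piW=> y.
rewrite -[tal_pi x + _]/(tal_add _ _) -[RHS]/(tal_add _ _) tal_pi_cat.
by rewrite !tal_shift_pi tal_pi_cat /word_shift map_cat.
Qed.

HB.instance Definition _ n :=
  GRing.isNmodMorphism.Build talented talented (tal_shift n)
    (tal_shift_is_nmod_morphism n).

Lemma tal_shift0 x : tal_shift 0 x = x.
Proof.
elim/tal_piW: x => x; rewrite tal_shift_pi /word_shift.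
congr tal_pi; rewrite -[RHS]map_id.
by apply: eq_map => -[v m] /=; rewrite addr0.
Qed.

Lemma tal_shiftD m n x : tal_shift (m + n) x = tal_shift m (tal_shift n x).
Proof.
elim/tal_piW: x => x; rewrite !tal_shift_pi /word_shift -map_comp.
by congr tal_pi; apply: eq_map => -[v p] /=; rewrite -addrA [n + m]addrC.
Qed.

Definition periodic (a : talented) : Prop :=
  a <> 0 /\ exists n : 'rV[int]_k, n <> 0 /\ tal_shift n a = a.

Definition aperiodic (a : talented) : Prop := a <> 0 /\ ~ periodic a.

Definition aperiodic_atom (a : talented) : Prop := aperiodic a /\ atom a.

Record order_ideal (J : set talented) : Prop := OrderIdeal {
  order_ideal0 : J 0;
  order_idealD : forall x y, J x -> J y -> J (x + y);
  order_ideal_shift : forall n x, J x -> J (tal_shift n x);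
  order_ideal_le : forall x y, alg_le x y -> J y -> J x
}.

Definition order_ideal_gen (S : set talented) : set talented :=
  smallest order_ideal S.

(* $\mathcal{A}$ and $H_{\mathcal{A}}$ *)
Definition aperiodic_ideal : set talented := order_ideal_gen aperiodic_atom.

Definition aperiodic_vtx : set (vtx L) :=
  [set v | aperiodic_ideal (tal_gen v 0)].

End Talented.

Arguments tal_gen {k} L v n.
Arguments aperiodic_vtx {k} L.

HB.mixin Record Lmodule_isNuAlgebra (R : comPzRingType) V
    of GRing.Lmodule R V := {
  numul : V -> V -> V;
  numulA : associative numul;
  numulDl : left_distributive numul +%R;
  numulDr : right_distributive numul +%R;
  numulZl : forall (a : R) (x y : V), numul (a *: x) y = a *: numul x y;
  numulZr : forall (a : R) (x y : V), numul x (a *: y) = a *: numul x y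
}.

#[short(type="nuAlgType")]
HB.structure Definition NuAlgebra (R : comPzRingType) :=
  { V of Lmodule_isNuAlgebra R V & GRing.Lmodule R V }.

Notation "x ** y" := (numul x y) (at level 40, left associativity) : ring_scope.

(* Ideals of a K-algebra are required to be K-subspaces. In an algebra with
   local units, such as a Kumjian-Pask algebra, this is automatic. *)
Section Ideals.
Variables (K : fieldType) (A : nuAlgType K).

Record subspace (I : set A) : Prop := Subspace {
  subspace0 : I 0;
  subspaceD : forall x y, I x -> I y -> I (x + y);
  subspaceZ : forall (c : K) x, I x -> I (c *: x)
}.

Definition left_ideal (I : set A) : Prop :=
  subspace I /\ forall a x, I x -> I (a ** x).

Definition ideal (I : set A) : Prop :=
  left_ideal I /\ forall a x, I x -> I (x ** a).

Definition minimal_left_ideal (I : set A) : Prop :=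
  [/\ left_ideal I, I <> [set 0] &
      forall J, left_ideal J -> J `<=` I -> J = [set 0] \/ J = I].

Definition ideal_gen (S : set A) : set A := smallest ideal S.

Definition essential_ideal (I : set A) : Prop :=
  ideal I /\ forall J, ideal J -> J <> [set 0] -> I `&` J <> [set 0].

Definition left_mul_ideal (x : A) : set A := range (fun a => a ** x).

End Ideals.

Definition socle (K : fieldType) (A : nuAlgType K) : set A :=
  [set x | exists s : seq A,
    (forall y, y \in s -> exists2 I, minimal_left_ideal I & I y) /\
    x = \sum_(y <- s) y].

Arguments socle {K} A.

(* [p], [s], [t] give the elements $p_v$, $s_\lambda$, $s_{\lambda^*}$ of an
   algebra, with $s_v = s_{v^*} = p_v$ for vertices. *)
Record kp_family (k : nat) (L : kgraph k) (K : fieldType) (A : nuAlgType K)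
    (p : vtx L -> A) (s t : L -> A) : Prop := KPFamily {
  kpf_s0 : forall v, s (idm v) = p v;
  kpf_t0 : forall v, t (idm v) = p v;
  kpf1 : forall u v, p u ** p v = if u == v then p u else 0;
  kpf2_ss : forall l m, src l = rng m -> s l ** s m = s (comp l m);
  kpf2_tt : forall l m, src l = rng m -> t m ** t l = t (comp l m);
  kpf2_ps : forall l, p (rng l) ** s l = s l;
  kpf2_sp : forall l, s l ** p (src l) = s l;
  kpf2_pt : forall l, p (src l) ** t l = t l;
  kpf2_tp : forall l, t l ** p (rng l) = t l;
  kpf3 : forall l m, deg l = deg m ->
    t l ** s m = if l == m then p (src l) else 0;
  kpf4 : forall v n, p v = \sum_(l <- fset_set (paths L v n)) s l ** t l
}.

Section KumjianPask.
Variables (k : nat) (L : kgraph k) (K : fieldType).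

Definition nonvtx := {l : L | deg l != 0}.

Inductive kp_term :=
| KPp of vtx L
| KPs of nonvtx
| KPt of nonvtx
| KPzero
| KPadd of kp_term & kp_term
| KPscale of K & kp_term
| KPmul of kp_term & kp_term.

HB.instance Definition _ := gen_eqMixin kp_term.
HB.instance Definition _ := gen_choiceMixin kp_term.

(* $s_\lambda$ and $s_{\lambda^*}$ for arbitrary $\lambda$; a path of degree 0
   is an identity (see [deg0_idm]), so the convention $s_v = s_{v^*} = p_v$ is
   applied to its range. *)
Definition term_s (l : L) : kp_term :=
  if insub l is Some l' then KPs l' else KPp (rng l).

Definition term_t (l : L) : kp_term :=
  if insub l is Some l' then KPt l' else KPp (rng l).

Inductive kp_eqv : kp_term -> kp_term -> Prop :=
| kp_refl x : kp_eqv x x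
| kp_sym x y : kp_eqv x y -> kp_eqv y x
| kp_trans x y z : kp_eqv x y -> kp_eqv y z -> kp_eqv x z
| kp_add x x' y y' : kp_eqv x x' -> kp_eqv y y' ->
    kp_eqv (KPadd x y) (KPadd x' y')
| kp_scale a x x' : kp_eqv x x' -> kp_eqv (KPscale a x) (KPscale a x')
| kp_mul x x' y y' : kp_eqv x x' -> kp_eqv y y' ->
    kp_eqv (KPmul x y) (KPmul x' y')
| kp_addA x y z : kp_eqv (KPadd x (KPadd y z)) (KPadd (KPadd x y) z)
| kp_addC x y : kp_eqv (KPadd x y) (KPadd y x)
| kp_add0 x : kp_eqv (KPadd KPzero x) x
| kp_addN x : kp_eqv (KPadd (KPscale (-1) x) x) KPzero
| kp_scaleA a b x : kp_eqv (KPscale a (KPscale b x)) (KPscale (a * b) x)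
| kp_scale1 x : kp_eqv (KPscale 1 x) x
| kp_scaleDr a x y :
    kp_eqv (KPscale a (KPadd x y)) (KPadd (KPscale a x) (KPscale a y))
| kp_scaleDl a b x :
    kp_eqv (KPscale (a + b) x) (KPadd (KPscale a x) (KPscale b x))
| kp_mulA x y z : kp_eqv (KPmul x (KPmul y z)) (KPmul (KPmul x y) z)
| kp_mulDl x y z : kp_eqv (KPmul (KPadd x y) z) (KPadd (KPmul x z) (KPmul y z))
| kp_mulDr x y z : kp_eqv (KPmul x (KPadd y z)) (KPadd (KPmul x y) (KPmul x z))
| kp_mulZl a x y : kp_eqv (KPmul (KPscale a x) y) (KPscale a (KPmul x y))
| kp_mulZr a x y : kp_eqv (KPmul x (KPscale a y)) (KPscale a (KPmul x y))
| kp1 u v : kp_eqv (KPmul (KPp u) (KPp v)) (if u == v then KPp u else KPzero)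
| kp2_ss l m : src l = rng m ->
    kp_eqv (KPmul (term_s l) (term_s m)) (term_s (comp l m))
| kp2_tt l m : src l = rng m ->
    kp_eqv (KPmul (term_t m) (term_t l)) (term_t (comp l m))
| kp2_ps l : kp_eqv (KPmul (KPp (rng l)) (term_s l)) (term_s l)
| kp2_sp l : kp_eqv (KPmul (term_s l) (KPp (src l))) (term_s l)
| kp2_pt l : kp_eqv (KPmul (KPp (src l)) (term_t l)) (term_t l)
| kp2_tp l : kp_eqv (KPmul (term_t l) (KPp (rng l))) (term_t l)
| kp3 l m : deg l = deg m ->
    kp_eqv (KPmul (term_t l) (term_s m))
           (if l == m then KPp (src l) else KPzero)
| kp4 v n :
    kp_eqv (KPp v)
      (\big[KPadd/KPzero]_(l <- fset_set (paths L v n))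
          KPmul (term_s l) (term_t l)).

Definition kp_rel_bool (x y : kp_term) : bool := `[< kp_eqv x y >].

Lemma kp_rel_bool_equiv : equiv_class_of kp_rel_bool.
Proof.
split=> [x|x y|y x z].
- by apply/asboolP; apply: kp_refl.
- by apply/asboolP/asboolP; apply: kp_sym.
- by move=> /asboolP xy /asboolP yz; apply/asboolP; apply: kp_trans yz.
Qed.

Canonical kp_equiv := EquivRelPack kp_rel_bool_equiv.

Definition KP := {eq_quot kp_equiv}.

HB.instance Definition _ := Choice.on KP.
HB.instance Definition _ := EqQuotient.on KP.

Definition kp_pi (x : kp_term) : KP := \pi_KP x.

Lemma kp_piP x y : kp_pi x = kp_pi y <-> kp_eqv x y.
Proof. by split=> [/eqmodP/asboolP//|h]; apply/eqmodP/asboolP. Qed.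

Lemma kp_reprK x : kp_pi (repr x) = x.
Proof. exact: reprK. Qed.

Lemma kp_piW (P : KP -> Prop) : (forall x, P (kp_pi x)) -> forall x, P x.
Proof. by move=> h x; rewrite -(kp_reprK x). Qed.

Lemma kp_repr_eqv x : kp_eqv (repr (kp_pi x)) x.
Proof. by apply/kp_piP; rewrite kp_reprK. Qed.

Definition kp_qadd (x y : KP) : KP := kp_pi (KPadd (repr x) (repr y)).
Definition kp_qscale (a : K) (x : KP) : KP := kp_pi (KPscale a (repr x)).
Definition kp_qmul (x y : KP) : KP := kp_pi (KPmul (repr x) (repr y)).

Lemma kp_qaddE x y : kp_qadd (kp_pi x) (kp_pi y) = kp_pi (KPadd x y).
Proof. by apply/kp_piP; apply: kp_add; apply: kp_repr_eqv. Qed.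

Lemma kp_qscaleE a x : kp_qscale a (kp_pi x) = kp_pi (KPscale a x).
Proof. by apply/kp_piP; apply: kp_scale; apply: kp_repr_eqv. Qed.

Lemma kp_qmulE x y : kp_qmul (kp_pi x) (kp_pi y) = kp_pi (KPmul x y).
Proof. by apply/kp_piP; apply: kp_mul; apply: kp_repr_eqv. Qed.

Let kp_qE := (kp_qaddE, kp_qscaleE, kp_qmulE).

Fact kp_qaddA : associative kp_qadd.
Proof.
elim/kp_piW=> x; elim/kp_piW=> y; elim/kp_piW=> z; rewrite !kp_qE.
exact/kp_piP/kp_addA.
Qed.

Fact kp_qaddC : commutative kp_qadd.
Proof.
by elim/kp_piW=> x; elim/kp_piW=> y; rewrite !kp_qE; apply/kp_piP/kp_addC.
Qed.

Fact kp_qadd0 : left_id (kp_pi KPzero) kp_qadd.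
Proof. by elim/kp_piW=> x; rewrite !kp_qE; apply/kp_piP/kp_add0. Qed.

Fact kp_qaddN : left_inverse (kp_pi KPzero) (kp_qscale (-1)) kp_qadd.
Proof. by elim/kp_piW=> x; rewrite !kp_qE; apply/kp_piP/kp_addN. Qed.

HB.instance Definition _ :=
  GRing.isZmodule.Build KP kp_qaddA kp_qaddC kp_qadd0 kp_qaddN.

Lemma kp_piD x y : kp_pi (KPadd x y) = kp_pi x + kp_pi y.
Proof. by rewrite -kp_qaddE. Qed.

Fact kp_qscaleA a b x : kp_qscale a (kp_qscale b x) = kp_qscale (a * b) x.
Proof. by elim/kp_piW: x => x; rewrite !kp_qE; apply/kp_piP/kp_scaleA. Qed.

Fact kp_qscale1 : left_id 1 kp_qscale.
Proof. by elim/kp_piW=> x; rewrite !kp_qE; apply/kp_piP/kp_scale1. Qed.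

Fact kp_qscaleDr : right_distributive kp_qscale +%R.
Proof.
move=> a; elim/kp_piW=> x; elim/kp_piW=> y.
by rewrite -kp_piD !kp_qE -kp_piD; apply/kp_piP/kp_scaleDr.
Qed.

Fact kp_qscaleDl x : {morph kp_qscale^~ x : a b / a + b}.
Proof.
move=> a b; elim/kp_piW: x => x.
by rewrite !kp_qE -kp_piD; apply/kp_piP/kp_scaleDl.
Qed.

HB.instance Definition _ := GRing.Zmodule_isLmodule.Build K KP
  kp_qscaleA kp_qscale1 kp_qscaleDr kp_qscaleDl.

Lemma kp_piZ a x : kp_pi (KPscale a x) = a *: kp_pi x.
Proof. by rewrite -kp_qscaleE. Qed.

Fact kp_qmulA : associative kp_qmul.
Proof.
elim/kp_piW=> x; elim/kp_piW=> y; elim/kp_piW=> z; rewrite !kp_qE.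
exact/kp_piP/kp_mulA.
Qed.

Fact kp_qmulDl : left_distributive kp_qmul +%R.
Proof.
elim/kp_piW=> x; elim/kp_piW=> y; elim/kp_piW=> z.
by rewrite -kp_piD !kp_qE -kp_piD; apply/kp_piP/kp_mulDl.
Qed.

Fact kp_qmulDr : right_distributive kp_qmul +%R.
Proof.
elim/kp_piW=> x; elim/kp_piW=> y; elim/kp_piW=> z.
by rewrite -kp_piD !kp_qE -kp_piD; apply/kp_piP/kp_mulDr.
Qed.

Fact kp_qmulZl (a : K) (x y : KP) : kp_qmul (a *: x) y = a *: kp_qmul x y.
Proof.
elim/kp_piW: x => x; elim/kp_piW: y => y.
by rewrite -kp_piZ !kp_qE -kp_piZ; apply/kp_piP/kp_mulZl.
Qed.

Fact kp_qmulZr (a : K) (x y : KP) : kp_qmul x (a *: y) = a *: kp_qmul x y.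
Proof.
elim/kp_piW: x => x; elim/kp_piW: y => y.
by rewrite -kp_piZ !kp_qE -kp_piZ; apply/kp_piP/kp_mulZr.
Qed.

HB.instance Definition _ := Lmodule_isNuAlgebra.Build K KP
  kp_qmulA kp_qmulDl kp_qmulDr kp_qmulZl kp_qmulZr.

Lemma kp_piM x y : kp_pi (KPmul x y) = kp_pi x ** kp_pi y.
Proof. by rewrite -kp_qmulE. Qed.

Definition kp_p (v : vtx L) : KP := kp_pi (KPp v).
Definition kp_s (l : L) : KP := kp_pi (term_s l).
Definition kp_t (l : L) : KP := kp_pi (term_t l).

(* [KP] with [kp_p], [kp_s], [kp_t] is the universal Kumjian-Pask family. *)
Lemma kp_family_KP : kp_family kp_p kp_s kp_t.
Proof.
split; rewrite /kp_p /kp_s /kp_t.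
- by move=> v; rewrite /term_s insubN ?deg_idm ?eqxx// rng_idm.
- by move=> v; rewrite /term_t insubN ?deg_idm ?eqxx// rng_idm.
- move=> u v; rewrite -kp_piM; have /kp_piP -> := kp1 u v.
  by case: ifP.
- by move=> l m lm; rewrite -kp_piM; apply/kp_piP/kp2_ss.
- by move=> l m lm; rewrite -kp_piM; apply/kp_piP/kp2_tt.
- by move=> l; rewrite -kp_piM; apply/kp_piP/kp2_ps.
- by move=> l; rewrite -kp_piM; apply/kp_piP/kp2_sp.
- by move=> l; rewrite -kp_piM; apply/kp_piP/kp2_pt.
- by move=> l; rewrite -kp_piM; apply/kp_piP/kp2_tp.
- move=> l m /kp3; rewrite -kp_piM => /kp_piP ->.
  by case: ifP.
- move=> v n; have /kp_piP -> := kp4 v n.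
  elim/big_rec2: _ => [|l x y _ <-]; first by [].
  by rewrite kp_piD kp_piM.
Qed.

Lemma deg0_idm (l : L) : deg l = 0 -> l = idm (rng l).
Proof.
move=> l0; have l00 : deg l = 0 + 0 by rewrite l0 addr0.
have [q [_ uq]] := factorization l00.
have e1 : q = (idm (rng l), l).
  by apply: uq; split; rewrite //= ?src_idm ?comp_idl ?deg_idm.
have e2 : q = (l, idm (src l)).
  by apply: uq; split; rewrite //= ?rng_idm ?comp_idr ?deg_idm.
by move: e2; rewrite e1 => -[].
Qed.

Lemma kp_universal (A : nuAlgType K) (p : vtx L -> A) (s t : L -> A) :
  kp_family p s t ->
  exists! f : KP -> A,
    [/\ [/\ forall x y, f (x + y) = f x + f y,
            forall (a : K) x, f (a *: x) = a *: f x
          & forall x y, f (x ** y) = f x ** f y],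
        forall v, f (kp_p v) = p v,
        forall l, f (kp_s l) = s l
      & forall l, f (kp_t l) = t l].
Proof.
move=> F.
pose ev := fix ev (x : kp_term) : A := match x with
  | KPp v => p v | KPs l => s (val l) | KPt l => t (val l)
  | KPzero => 0 | KPadd x y => ev x + ev y
  | KPscale a x => a *: ev x | KPmul x y => ev x ** ev y end.
have evs l : ev (term_s l) = s l.
  rewrite /term_s; case: insubP => [l' _ <- //|/negPn/eqP/deg0_idm {2}->] /=.
  by rewrite (kpf_s0 F).
have evt l : ev (term_t l) = t l.
  rewrite /term_t; case: insubP => [l' _ <- //|/negPn/eqP/deg0_idm {2}->] /=.
  by rewrite (kpf_t0 F).
have evP x y : kp_eqv x y -> ev x = ev y.
  elim=> {x y} //=.
  - by move=> x y z _ -> _ ->.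
  - by move=> x x' y y' _ -> _ ->.
  - by move=> a x x' _ ->.
  - by move=> x x' y y' _ -> _ ->.
  - by move=> x y z; rewrite addrA.
  - by move=> x y; rewrite addrC.
  - by move=> x; rewrite add0r.
  - by move=> x; rewrite scaleN1r addNr.
  - by move=> a b x; rewrite scalerA.
  - by move=> x; rewrite scale1r.
  - by move=> a x y; rewrite scalerDr.
  - by move=> a b x; rewrite scalerDl.
  - by move=> x y z; rewrite numulA.
  - by move=> x y z; rewrite numulDl.
  - by move=> x y z; rewrite numulDr.
  - by move=> a x y; rewrite numulZl.
  - by move=> a x y; rewrite numulZr.
  - by move=> u v; rewrite (kpf1 F); case: ifP.
  - by move=> l m lm; rewrite !evs (kpf2_ss F).
  - by move=> l m lm; rewrite !evt (kpf2_tt F).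
  - by move=> l; rewrite !evs (kpf2_ps F).
  - by move=> l; rewrite !evs (kpf2_sp F).
  - by move=> l; rewrite !evt (kpf2_pt F).
  - by move=> l; rewrite !evt (kpf2_tp F).
  - by move=> l m lm; rewrite evs evt (kpf3 F)//; case: ifP.
  - move=> v n; rewrite (kpf4 F v n).
    by elim/big_rec2: _ => //= l x y _ ->; rewrite evs evt.
pose f (x : KP) := ev (repr x).
have fE x : f (kp_pi x) = ev x by apply/evP/kp_repr_eqv.
exists f; split.
  split; [split|..].
  - elim/kp_piW=> x; elim/kp_piW=> y.
    by rewrite -kp_piD !fE.
  - by move=> a; elim/kp_piW=> x; rewrite -kp_piZ !fE.
  - elim/kp_piW=> x; elim/kp_piW=> y.
    by rewrite -kp_piM !fE.
  - by move=> v; rewrite fE.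
  - by move=> l; rewrite fE.
  - by move=> l; rewrite fE.
move=> g [[gD gZ gM] gp gs gt]; apply/funext; elim/kp_piW=> x; rewrite fE.
elim: x => [v|l|l||x IHx y IHy|a x IHx|x IHx y IHy] /=.
- by rewrite -gp.
- by rewrite -gs /kp_s /term_s valK.
- by rewrite -gt /kp_t /term_t valK.
- by rewrite -[kp_pi KPzero](scale0r (0 : KP)) gZ scale0r.
- by rewrite kp_piD gD IHx IHy.
- by rewrite kp_piZ gZ IHx.
- by rewrite kp_piM gM IHx IHy.
Qed.

End KumjianPask.

Arguments KP {k} L K.
Arguments kp_p {k L} K v.

(* Main.v *)
Require Import Defs.
From HB Require Import structures.
From mathcomp Require Import all_boot all_order all_algebra.
From mathcomp Require Import finmap boolp classical_sets cardinality.

Set Implicit Arguments.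
Unset Strict Implicit.
Unset Printing Implicit Defensive.

(** A vertex [v] is called here a line vertex when the paths out of [v] are
    determined by their degree, and also by their source. The proof compares
    both sides of each equivalence with this notion.

    On the monoid side, a word in the symbols [v(n)] can be developed by the
    defining relations up to any high level [N] in Z^k, and two words represent
    the same element exactly when they develop into the same multiset of
    vertices at high levels ([tal_eqv_expand]). Hence the talented monoid has
    no nonzero unit, [v(n)] is an aperiodic atom if and only if [v] is a line
    vertex ([aperiodic_atomP]), and [v(0)] lies in the ideal generated by the
    aperiodic atoms if and only if for some [n] all the paths of degree [n] out
    of [v] end in line vertices ([aperiodic_vtxP]).

    On the algebra side, every element is a linear combination of products
    [s l ** t m], and a nonzero [x] has a product [x ** s m] that is a linear
    combination of distinct paths with a common source, with at least one
    nonzero coefficient ([kp_reduction]). If that source is a line vertex, then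
    [t l] extracts the coefficient of [l] ([kp_t_sum_line]); so line vertices
    generate minimal left ideals.

    The converse rests on a representation of the Kumjian-Pask algebra on
    functions from infinite paths to K(X), in which a path of degree [n]
    multiplies by a power of X. It shows that the [p v] are nonzero. It also
    shows that a minimal left ideal cannot contain an element acting on an
    infinite path by a nonzero scalar [f] when some [V] acts there by a
    monomial of nonzero degree: minimality would give [a ** (z - V ** z) = z],
    that is an inverse of 1 - X^i / X^j among Laurent polynomials, which is
    absurd at X = 1 ([minimal_no_monomial]). Such a [V] exists as soon as two
    paths of different degrees with the same source have the same infinite
    extensions.

    For an arbitrary minimal left ideal [M], one translates a reduced element
    by paths until the set of paths [a] that interact with a fixed path [l] is
    smallest. If only [l] is left, a vertex, necessarily a line vertex,
    appears; otherwise the surviving paths have the same infinite extensions,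
    which has just been excluded. So [M] meets, hence lies in, the ideal of the
    line vertices ([minimal_left_ideal_line]). This gives the socle, and its
    essentiality follows from the same reduction. *)

Import Order.TTheory GRing.Theory Num.Theory.
Local Open Scope classical_set_scope.
Local Open Scope ring_scope.

(* The composition of paths, and not that of functions. *)
Local Notation comp := Defs.comp.

(** * Degrees *)

Section Degrees.
Variable k : nat.
Implicit Types m n : 'rV[nat]_k.

Lemma rvn_addI m : injective (+%R m).
Proof.
move=> n p /matrixP e; apply/matrixP=> i j; have := e i j.
by rewrite !mxE => /eqP; rewrite eqn_add2l => /eqP.
Qed.

Lemma rvn_subnKC m n : (forall i, (m 0%R i <= n 0%R i)%N) ->
  n = m + map2_mx subn n m.
Proof.
move=> le_mn; apply/matrixP=> i j; rewrite !mxE ord1.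
exact/esym/subnKC.
Qed.

(** Weighted size of a degree; the weights are the powers of [B]. *)
Definition wdeg (B : nat) n : nat := (\sum_(i < k) n 0%R i * B ^ i)%N.

Lemma wdeg0 B : wdeg B 0 = 0%N.
Proof. by rewrite /wdeg big1// => i _; rewrite mxE mul0n. Qed.

Lemma wdegD B m n : wdeg B (m + n) = (wdeg B m + wdeg B n)%N.
Proof.
by rewrite /wdeg -big_split; apply: eq_bigr => i _; rewrite mxE mulnDl.
Qed.

(** Finitely many degrees are separated by some weighted size: two distinct
    degrees give distinct polynomials [\sum_i n_i X^i], whose difference has
    finitely many roots. *)
Lemma wdeg_separates (s : seq 'rV[nat]_k) :
  exists B, {in s &, injective (wdeg B)}.
Proof.
pose P n : {poly int} := \sum_(i < k) (n 0 i)%:Z *: 'X^i.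
have PE n B : (P n).[B%:Z] = (wdeg B n)%:Z.
  rewrite /P horner_sum /wdeg (big_morph Posz PoszD (erefl _)).
  by apply: eq_bigr => i _; rewrite hornerZ hornerXn PoszM -!natz natrX.
have Pinj : injective P.
  move=> m n e; apply/matrixP=> i j; rewrite ord1.
  have PC p : (P p)`_j = (p 0 j)%:Z.
    rewrite /P coef_sum (bigD1 j)//= coefZ coefXn eqxx mulr1 big1 ?addr0//.
    move=> l lj.
    by rewrite coefZ coefXn eq_sym (inj_eq val_inj) (negbTE lj) mulr0.
  by have /eqP := congr1 (fun q : {poly int} => q`_j) e; rewrite !PC => /eqP[].
(* B is any non-root of the product of the nonzero differences. *)
pose D := \prod_(m <- s) \prod_(n <- s | m != n) (P m - P n).
have D0 : D != 0.
  rewrite prodf_seq_neq0; apply/allP=> m _; rewrite /= prodf_seq_neq0.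
  by apply/allP=> n _; apply/implyP=> mn; rewrite subr_eq0 (inj_eq Pinj).
have [B DB] : exists B : nat, D.[B%:Z] != 0.
  apply: contrapT => nB.
  have := @max_poly_roots _ D [seq i%:Z | i <- iota 0 (size D)] D0.
  rewrite size_map size_iota ltnn => H; suff: false by [].
  apply: H; last by rewrite map_inj_uniq ?iota_uniq// => a b [].
  apply/allP=> _ /mapP[i _ ->]; apply/rootP.
  by case: (eqVneq D.[i%:Z] 0) => // h; case: nB; exists i.
exists B => m n ms ns e; apply/eqP/negPn/negP => mn.
move: DB; rewrite horner_prod prodf_seq_neq0 => /allP/(_ m ms)/=.
rewrite horner_prod prodf_seq_neq0 => /allP/(_ n ns)/=; rewrite mn /=.
by rewrite hornerD hornerN !PE e subrr eqxx.
Qed.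

End Degrees.

(** * Factorization of paths *)

Section Paths.
Variables (k : nat) (L : kgraph k).
Implicit Types (l m a b c d : L) (n p q : 'rV[nat]_k) (u v w : vtx L).

Lemma factor_ex l n p : deg l = n + p ->
  exists q : L * L,
    [/\ src q.1 = rng q.2, comp q.1 q.2 = l, deg q.1 = n & deg q.2 = p].
Proof. by move=> /(@factorization _ L)[q [? _]]; exists q. Qed.

(** The factors [pfx l n] and [sfx l n] of [l = pfx l n * sfx l n] with [n] the
    degree of the first one; a junk value when [n] is not below [deg l]. *)
Definition factor l n : L * L :=
  if pselect (exists q : L * L,
    [/\ src q.1 = rng q.2, comp q.1 q.2 = l & deg q.1 = n]) is left e
  then projT1 (cid e) else (l, l).
Definition pfx l n := (factor l n).1.
Definition sfx l n := (factor l n).2.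

Lemma factorP l n p : deg l = n + p ->
  [/\ src (pfx l n) = rng (sfx l n), comp (pfx l n) (sfx l n) = l,
      deg (pfx l n) = n & deg (sfx l n) = p].
Proof.
move=> dl; rewrite /pfx /sfx /factor; case: pselect => [e|ne].
  case: (cid e) => q /= [sq cq dq]; split=> //.
  apply: (@rvn_addI _ n); rewrite -dl -[in RHS]cq deg_comp// dq.
  by [].
by case: ne; have [q [? ? ? _]] := factor_ex dl; exists q.
Qed.

Section FactorTheory.
Variables (l : L) (n p : 'rV[nat]_k).
Hypothesis dl : deg l = n + p.

Lemma pfx_sfx : src (pfx l n) = rng (sfx l n). Proof. by case: (factorP dl). Qed.
Lemma comp_pfx_sfx : comp (pfx l n) (sfx l n) = l.
Proof. by case: (factorP dl). Qed.
Lemma deg_pfx : deg (pfx l n) = n. Proof. by case: (factorP dl). Qed.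
Lemma deg_sfx : deg (sfx l n) = p. Proof. by case: (factorP dl). Qed.
Lemma rng_pfx : rng (pfx l n) = rng l.
Proof. by rewrite -[in RHS]comp_pfx_sfx rng_comp// pfx_sfx. Qed.
Lemma src_sfx : src (sfx l n) = src l.
Proof. by rewrite -[in RHS]comp_pfx_sfx src_comp// pfx_sfx. Qed.

End FactorTheory.

Lemma comp_inj a b c d : src a = rng b -> src c = rng d ->
  deg a = deg c -> comp a b = comp c d -> a = c /\ b = d.
Proof.
move=> ab cd dac e.
have dbd : deg b = deg d.
  by apply: (@rvn_addI _ (deg a)); rewrite -deg_comp// e deg_comp// dac.
have [q [_ uq]] := factorization (deg_comp ab).
have e1 : q = (a, b) by apply: uq; split.
have e2 : q = (c, d) by apply: uq; split=> //=.
by move: e2; rewrite e1 => -[].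
Qed.

Lemma factor_comp a b : src a = rng b ->
  pfx (comp a b) (deg a) = a /\ sfx (comp a b) (deg a) = b.
Proof.
move=> ab; have dab := deg_comp ab.
apply: comp_inj => //; first exact: pfx_sfx dab.
  exact: deg_pfx dab.
exact: comp_pfx_sfx dab.
Qed.

Lemma pfx_comp a b : src a = rng b -> pfx (comp a b) (deg a) = a.
Proof. by case/factor_comp. Qed.
Lemma sfx_comp a b : src a = rng b -> sfx (comp a b) (deg a) = b.
Proof. by case/factor_comp. Qed.

Lemma pfx_comp_le a b n p : src a = rng b -> deg a = n + p ->
  pfx (comp a b) n = pfx a n.
Proof.
move=> ab da; rewrite -[in LHS](comp_pfx_sfx da) -Defs.compA ?(pfx_sfx da)//.
  have := @pfx_comp (pfx a n) (comp (sfx a n) b); rewrite (deg_pfx da); apply.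
  by rewrite rng_comp ?(pfx_sfx da)// (src_sfx da).
by rewrite (src_sfx da).
Qed.

Lemma pfx_pfx l n p q : deg l = n + p + q -> pfx (pfx l (n + p)) n = pfx l n.
Proof.
move=> dl; rewrite -[in RHS](comp_pfx_sfx dl).
by rewrite (pfx_comp_le (p := p))// ?(pfx_sfx dl)// (deg_pfx dl).
Qed.

Lemma pfx_full l n : deg l = n -> pfx l n = l.
Proof. by move=> <-; rewrite -{1}[l]comp_idr pfx_comp// rng_idm. Qed.

Hypothesis L_rf : row_finite L.

(** An enumeration of the paths of degree [n] with range [v]; it is complete
    because the graph is row-finite. *)
Definition pathl v n : seq L := fset_set (paths L v n).

Lemma pathlP v n l : reflect (rng l = v /\ deg l = n) (l \in pathl v n).
Proof.
rewrite /pathl in_fset_set; last exact: L_rf.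
by apply: (iffP idP); rewrite inE.
Qed.

Lemma pathl_uniq v n : uniq (pathl v n).
Proof. exact: fset_uniq. Qed.

Lemma pathl0 v : perm_eq (pathl v 0) [:: idm v].
Proof.
apply: uniq_perm; rewrite ?pathl_uniq// => l; rewrite !inE.
apply/pathlP/eqP => [[<- /deg0_idm//]|->].
by rewrite rng_idm deg_idm.
Qed.

Lemma pathlD v n p :
  perm_eq (pathl v (n + p))
    (flatten [seq [seq comp a b | b <- pathl (src a) p] | a <- pathl v n]).
Proof.
apply: uniq_perm => [||l]; first exact: pathl_uniq.
  apply: allpairs_uniq_dep => [|a _|[a b] [c d]]; first exact: pathl_uniq.
    exact: pathl_uniq.
  case/allpairsPdep=> a' [b' [/pathlP[_ da] /pathlP[rb db]]].
  case/(congr1 (fun z : {_ : L & L : Type} => (tag z, tagged z)))=> -> ->.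
  case/allpairsPdep=> c' [d' [/pathlP[_ dc] /pathlP[rd dd]]].
  case/(congr1 (fun z : {_ : L & L : Type} => (tag z, tagged z)))=> -> -> /= e.
  by have [||| -> ->] := comp_inj _ _ _ e; rewrite ?rb ?rd ?da ?dc.
apply/pathlP/flatten_mapP => [[<- dl]|]; last first.
  case=> a /pathlP[ra da] /mapP[b /pathlP[rb db] ->].
  by rewrite rng_comp ?deg_comp// ra da db.
exists (pfx l n); first by apply/pathlP; rewrite (rng_pfx dl) (deg_pfx dl).
apply/mapP; exists (sfx l n); last by rewrite (comp_pfx_sfx dl).
by apply/pathlP; rewrite (deg_sfx dl) (pfx_sfx dl).
Qed.

End Paths.

(** * Infinite paths *)

Section InfinitePaths.
Variables (k : nat) (L : kgraph k).
Implicit Types (l m : L) (n p q : 'rV[nat]_k) (v : vtx L).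

(** An infinite path is a coherent family of finite paths, one in each degree:
    [x n] is the initial segment of degree [n]. *)
Definition infpath (x : 'rV[nat]_k -> L) : Prop :=
  forall n p, deg (x n) = n /\ pfx (x (n + p)) n = x n.

(** Concatenation with a finite path, and removal of an initial segment. *)
Definition icat l (x : 'rV[nat]_k -> L) n : L := pfx (comp l (x n)) n.
Definition ishift n (x : 'rV[nat]_k -> L) p : L := sfx (x (n + p)) n.

Section Theory.
Variable x : 'rV[nat]_k -> L.
Hypothesis xinf : infpath x.

Lemma inf_deg n : deg (x n) = n. Proof. by case: (xinf n 0). Qed.
Lemma inf_pfx n p : pfx (x (n + p)) n = x n. Proof. by case: (xinf n p). Qed.

Lemma inf_src n p : src (x n) = rng (ishift n x p).
Proof. by rewrite -(inf_pfx n p) (pfx_sfx (inf_deg _)). Qed.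

Lemma inf_split n p : x (n + p) = comp (x n) (ishift n x p).
Proof. by rewrite -[LHS](comp_pfx_sfx (inf_deg (n + p))) inf_pfx. Qed.

Lemma ishift_deg n p : deg (ishift n x p) = p.
Proof. exact: deg_sfx (inf_deg _). Qed.

Lemma inf_rng n : rng (x n) = rng (x 0).
Proof. by rewrite -[n]add0r inf_split rng_comp//; exact: inf_src. Qed.

Lemma infpath_shift n : infpath (ishift n x).
Proof.
move=> p q; split; first exact: ishift_deg.
have sp := inf_src (n + p) q; have sn := inf_src n p.
have e : ishift n x (p + q) = comp (ishift n x p) (ishift (n + p) x q).
  have [|||| _ //] := @comp_inj _ L (x n) (ishift n x (p + q)) (x n)
      (comp (ishift n x p) (ishift (n + p) x q)).
  - exact: inf_src.
  - by rewrite rng_comp// -sp inf_split src_comp.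
  - by [].
  rewrite Defs.compA//; first by rewrite -!inf_split addrA.
  by rewrite -sp inf_split src_comp.
rewrite e; have := @pfx_comp _ _ (ishift n x p) (ishift (n + p) x q).
rewrite ishift_deg; apply.
by rewrite -sp inf_split src_comp.
Qed.

Lemma ishift_rng n : rng (ishift n x 0) = src (x n).
Proof. exact/esym/inf_src. Qed.

Lemma infpath_cat l : src l = rng (x 0) -> infpath (icat l x).
Proof.
move=> lx n p; have lxn q : src l = rng (x q) by rewrite inf_rng.
have dc q : deg (comp l (x q)) = q + deg l.
  by rewrite deg_comp// inf_deg addrC.
rewrite /icat; split; first exact: deg_pfx (dc n).
rewrite (pfx_pfx (dc _)) inf_split Defs.compA//; last exact: inf_src.
rewrite (pfx_comp_le (p := deg l))// ?src_comp//; exact: inf_src.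
Qed.

Lemma icat_comp l n : src l = rng (x 0) -> icat l x (deg l + n) = comp l (x n).
Proof.
move=> lx; have lxn q : src l = rng (x q) by rewrite inf_rng.
rewrite /icat [deg l + n]addrC inf_split Defs.compA//; last exact: inf_src.
rewrite (pfx_comp_le (p := 0)) ?src_comp//; last 2 first.
- exact: inf_src.
- by rewrite deg_comp// inf_deg addr0 addrC.
by rewrite pfx_full// deg_comp// inf_deg addrC.
Qed.

Lemma icat_pfx l : src l = rng (x 0) -> icat l x (deg l) = l.
Proof.
move=> lx; rewrite -[deg l]addr0 icat_comp//.
by rewrite [x 0]deg0_idm ?inf_deg// -lx comp_idr.
Qed.

Lemma icat_rng l : src l = rng (x 0) -> rng (icat l x 0) = rng l.
Proof.
move=> lx; have dc : deg (comp l (x 0)) = 0 + deg l.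
  by rewrite deg_comp// inf_deg addr0 add0r.
by rewrite /icat (rng_pfx dc) rng_comp.
Qed.

Lemma ishift_cat l : src l = rng (x 0) -> ishift (deg l) (icat l x) = x.
Proof.
move=> lx; apply/funext=> n; rewrite /ishift icat_comp// sfx_comp//.
by rewrite inf_rng.
Qed.

Lemma icat_shift n : icat (x n) (ishift n x) = x.
Proof. by apply/funext=> p; rewrite /icat -inf_split addrC inf_pfx. Qed.

Lemma ishiftD n p : ishift p (ishift n x) = ishift (n + p) x.
Proof.
apply/funext=> q; rewrite /ishift /=.
have sn := inf_src n p; have sp := inf_src (n + p) q.
have sn' := inf_src n (p + q).
have si : src (ishift n x p) = rng (ishift (n + p) x q).
  by rewrite -sp inf_split src_comp.
rewrite -[sfx (x (n + _)) n]/(ishift n x (p + q)).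
rewrite -[RHS]/(ishift (n + p) x q).
have [|||| _ ->] := @comp_inj _ L (x n) (ishift n x (p + q)) (x n)
      (comp (ishift n x p) (ishift (n + p) x q)) => //.
- by rewrite rng_comp.
- by rewrite Defs.compA// -!inf_split addrA.
have /(_ si) := @sfx_comp _ _ (ishift n x p) (ishift (n + p) x q).
by rewrite ishift_deg.
Qed.

End Theory.

Lemma inf_ext x y : infpath x -> infpath y ->
  (forall n, exists p, x (n + p) = y (n + p)) -> x = y.
Proof.
move=> xi yi e; apply/funext=> n; have [p en] := e n.
by rewrite -(inf_pfx xi n p) en (inf_pfx yi).
Qed.

Lemma icatD l m x : infpath x -> src l = rng m -> src m = rng (x 0) ->
  icat (comp l m) x = icat l (icat m x).
Proof.
move=> xi lm mx.
have mi := infpath_cat xi mx.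
have lmx : src l = rng (icat m x 0) by rewrite icat_rng.
have lx : src (comp l m) = rng (x 0) by rewrite src_comp.
apply: inf_ext; [exact: infpath_cat|exact: infpath_cat|move=> n].
exists (deg l + deg m); rewrite addrC -{1}(deg_comp lm) icat_comp//.
by rewrite -addrA icat_comp// icat_comp// Defs.compA// mx (inf_rng xi).
Qed.

Hypothesis L_ns : no_sources L.

Lemma infpath_ex v : exists2 x, infpath x & rng (x 0) = v.
Proof.
(* Paths [z j] of degree (j, ..., j), each extending the previous one. *)
have /choice[g gP] u : exists a : L, rng a = u /\ deg a = const_mx 1%N.
  by have [a [? ?]] := L_ns u (const_mx 1%N); exists a.
pose z := fix z j := if j is i.+1 then comp (z i) (g (src (z i))) else idm v.
have zg j : src (z j) = rng (g (src (z j))) by rewrite (gP _).1.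
have dz j : deg (z j) = const_mx j.
  elim: j => [|j IH] /=; last first.
    rewrite deg_comp// IH (gP _).2; apply/matrixP=> a b.
    by rewrite !mxE -[LHS]/(_ + _)%N addn1.
  by rewrite deg_idm; apply/matrixP=> a b; rewrite !mxE.
have rz j : rng (z j) = v by elim: j => [|j IH] /=; rewrite ?rng_idm// rng_comp.
have zD (i j : nat) n p : const_mx i = n + p -> pfx (z (j + i)%N) n = pfx (z i) n.
  move=> ip; elim: j => [//|j IH]; rewrite addSn /= -IH.
  apply: (pfx_comp_le (p := const_mx j + p)); first exact: zg.
  rewrite dz addrCA -ip; apply/matrixP=> a b; by rewrite !mxE.
pose N (n : 'rV[nat]_k) := (\sum_i n 0%R i)%N.
have NP n : exists p, const_mx (N n) = n + p.
  exists (map2_mx subn (const_mx (N n)) n); apply: rvn_subnKC => i.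
  by rewrite mxE /N (bigD1 i)//= leq_addr.
have zN (i : nat) n p : const_mx i = n + p -> pfx (z i) n = pfx (z (N n)) n.
  move=> ip; have [q nq] := NP n.
  by rewrite -(zD _ (N n) _ _ ip) addnC (zD _ _ _ _ nq).
pose x n := pfx (z (N n)) n.
exists x; last first.
  by rewrite /x; have [q nq] := NP 0; rewrite (@rng_pfx _ _ _ _ q) ?rz// dz.
move=> n p; have [q nq] := NP (n + p); split.
  by have [r nr] := NP n; rewrite /x (@deg_pfx _ _ _ _ r)// dz.
rewrite /x (@pfx_pfx _ _ _ _ _ q) ?dz//.
by apply: (zN _ _ (p + q)); rewrite addrA.
Qed.

End InfinitePaths.

(** * Levels *)

Section Levels.
Variable k : nat.

Lemma rvn_ind (P : 'rV[nat]_k -> Prop) : P 0 ->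
  (forall i m, P m -> P (delta_mx 0 i + m)) -> forall m, P m.
Proof.
move=> P0 PS m; have [s] := ubnP (\sum_i m 0%R i)%N.
elim: s m => // s IH m ms; have [->//|/rowP] := pselect (m = 0).
move/existsNP=> [i]; rewrite mxE => /eqP; rewrite -lt0n => mi.
have e : m = delta_mx 0 i + map2_mx subn m (delta_mx 0 i).
  apply: rvn_subnKC => j; rewrite mxE eqxx /=.
  by case: eqVneq => [->|].
rewrite e; apply: PS; apply: IH; move: ms; rewrite (bigD1 i)//= => ms.
rewrite (bigD1 i)//= !mxE !eqxx /= subn1.
rewrite (eq_bigr (fun j => m 0 j)) => [|j ji]; last first.
  by rewrite !mxE eqxx (negbTE ji) subn0.
by rewrite -ltnS (leq_trans _ ms)// -addSn prednK.
Qed.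

(** The filter of the upper sections of the product order of [Z^k]. *)
Definition far (Q : 'rV[int]_k -> Prop) : Prop :=
  exists N0 : 'rV[int]_k,
    forall N : 'rV[int]_k, (forall i, N0 0 i <= N 0 i) -> Q N.

Lemma farW Q : (forall N, Q N) -> far Q.
Proof. by move=> q; exists 0 => N _. Qed.

Lemma far_ge (n : 'rV[int]_k) :
  far (fun N : 'rV[int]_k => forall i, n 0 i <= N 0 i).
Proof. by exists n. Qed.

Lemma farI Q1 Q2 (Q : 'rV[int]_k -> Prop) : (forall N, Q1 N -> Q2 N -> Q N) ->
  far Q1 -> far Q2 -> far Q.
Proof.
move=> q [N1 h1] [N2 h2]; exists (map2_mx Order.max N1 N2) => N le_N.
by apply: q; [apply: h1|apply: h2] => i; have := le_N i;
  rewrite mxE ge_max => /andP[].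
Qed.

Lemma farS Q1 (Q : 'rV[int]_k -> Prop) : (forall N, Q1 N -> Q N) ->
  far Q1 -> far Q.
Proof. by move=> q [N1 h1]; exists N1 => N /h1/q. Qed.

Lemma far_ex Q : far Q -> exists N, Q N.
Proof. by case=> N h; exists N; apply: h. Qed.

Lemma map_absK (n N : 'rV[int]_k) : (forall i, n 0 i <= N 0 i) ->
  N = n + map_mx Posz (map_mx absz (N - n)).
Proof.
move=> le_nN; apply/matrixP=> i j; rewrite !mxE ord1 gez0_abs ?subr_ge0//.
by rewrite addrC subrK.
Qed.

Lemma map_Posz_inj : injective (map_mx Posz : 'rV[nat]_k -> 'rV[int]_k).
Proof.
by move=> m n /matrixP e; apply/matrixP=> i j; have := e i j; rewrite !mxE => -[].
Qed.

Lemma map_PoszD (m n : 'rV[nat]_k) :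
  map_mx Posz (m + n) = map_mx Posz m + map_mx Posz n.
Proof. by apply/matrixP=> i j; rewrite !mxE PoszD. Qed.

Lemma map_Posz_delta i :
  map_mx Posz (delta_mx 0 i : 'rV[nat]_k) = delta_mx 0 i.
Proof. by apply/matrixP=> a b; rewrite !mxE; case: andP. Qed.

End Levels.

(** * The talented monoid *)

Section Talented.
Variables (k : nat) (L : kgraph k).
Hypotheses (L_rf : row_finite L) (L_ns : no_sources L).
Implicit Types (l m : L) (u v w : vtx L) (x y z : tal_word L).

Lemma tal_piD x y : tal_pi (x ++ y) = tal_pi x + tal_pi y.
Proof. exact/esym/tal_pi_cat. Qed.

Lemma pathl_ex v n : exists l, l \in pathl v n.
Proof. by have [l [rl dl]] := L_ns v n; exists l; apply/pathlP. Qed.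

Lemma tal_gen_expand v (n : 'rV[int]_k) (m : 'rV[nat]_k) :
  tal_gen L v n = \sum_(a <- pathl v m) tal_gen L (src a) (n + map_mx Posz m).
Proof.
elim/rvn_ind: m v n => [|i m IH] v n.
  rewrite (perm_big _ (pathl0 L_rf v)) big_seq1 src_idm; congr tal_gen.
  by apply/matrixP=> a b; rewrite !mxE addr0.
rewrite (perm_big _ (pathlD L_rf v (delta_mx 0 i) m)) big_flatten /= big_map.
rewrite (@tal_genE _ _ v n i (L_ns v _)) -/(pathl v _).
rewrite [LHS]big_seq [RHS]big_seq.
apply: eq_bigr => a /pathlP[]// ra da.
rewrite (IH (src a)) big_map [LHS]big_seq [RHS]big_seq.
apply: eq_bigr => b /pathlP[]// rb db.
by rewrite src_comp// map_PoszD map_Posz_delta addrA.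
Qed.

(** The multiset of vertices at level [N] into which the relations of the
    talented monoid develop a word; meaningful once [N] is above all the
    levels that occur in the word. *)
Definition expand (N : 'rV[int]_k) x : seq (vtx L) :=
  flatten [seq [seq src a | a <- pathl g.1 (map_mx absz (N - g.2))] | g <- x].

Lemma expand_cat N x y : expand N (x ++ y) = expand N x ++ expand N y.
Proof. by rewrite /expand map_cat flatten_cat. Qed.

Lemma expand1 N v n :
  expand N [:: (v, n)] = [seq src a | a <- pathl v (map_mx absz (N - n))].
Proof. by rewrite /expand /= cats0. Qed.

Lemma expand_eq0 N x : expand N x = [::] -> x = [::].
Proof.
case: x => // -[v n] x; rewrite -cat1s expand_cat expand1.
by have [l] := pathl_ex v (map_mx absz (N - n)); case: pathl.
Qed.

(** The talented monoid is the direct limit of the free monoids on the vertices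
    of each level: equivalent words develop eventually into the same
    vertices. *)
Lemma tal_eqv_expand x y : tal_eqv x y ->
  far (fun N => perm_eq (expand N x) (expand N y)).
Proof.
elim=> {x y} [x y xy|v n i _|x x' y y' _ hx _ hy|x y _ h|x y z _ hxy _ hyz].
- by apply: farW => N; apply/perm_flatten/perm_map.
- apply: farS (far_ge (n + delta_mx 0 i)) => N le_N.
  rewrite expand1.
  have -> : map_mx absz (N - n) =
      delta_mx 0 i + map_mx absz (N - (n + delta_mx 0 i)).
    apply: map_Posz_inj; rewrite map_PoszD map_Posz_delta.
    have le_n j : n 0 j <= N 0 j.
      by apply: le_trans (le_N j); rewrite !mxE lerDl.
    by apply: (addrI n); rewrite addrA -map_absK// -map_absK.
  rewrite (permPl (perm_map _ (pathlD L_rf _ _ _))) map_flatten -map_comp.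
  rewrite /expand /tal_step -map_comp -/(pathl v _).
  have perm_flat (s1 s2 : seq (seq (vtx L))) : s1 = s2 ->
    perm_eq (flatten s1) (flatten s2) by move=> ->.
  apply/perm_flat/eq_in_map => a /pathlP[]// _ _ /=; rewrite -map_comp.
  by apply/eq_in_map => b /pathlP[]// rb _; rewrite /= src_comp.
- apply: farI hx hy => N; rewrite !expand_cat => h1 h2.
  exact: perm_cat.
- by apply: farS h => N; rewrite perm_sym.
- by apply: farI hxy hyz => N h1 h2; apply: perm_trans h2.
Qed.

Lemma tal_pi_eq0 x : tal_pi x = 0 -> x = [::].
Proof.
move/tal_piP/tal_eqv_expand/far_ex=> [N /perm_nilP].
exact: expand_eq0.
Qed.

Lemma tal_gen_neq0 v n : tal_gen L v n <> 0.
Proof. by move/tal_pi_eq0. Qed.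

Lemma tal_unitP (a : talented L) : is_unit a <-> a = 0.
Proof.
split=> [[b]|->]; last by exists 0; rewrite addr0.
elim/tal_piW: a => x; elim/tal_piW: b => y; rewrite -tal_piD => /esym/tal_pi_eq0.
by case: x.
Qed.

Lemma tal_gen_le_path v n l : rng l = v ->
  alg_le (tal_gen L (src l) (n + map_mx Posz (deg l))) (tal_gen L v n).
Proof.
move=> rl; rewrite (tal_gen_expand v n (deg l)).
have lv : l \in pathl v (deg l) by apply/pathlP.
by rewrite (bigD1_seq l) ?pathl_uniq//=; eexists.
Qed.

(** A vertex is a line vertex when a path out of it is determined by its degree,
    and also by its source. *)
Definition line_vtx v : Prop := forall l m, rng l = v -> rng m = v ->
  deg l = deg m \/ src l = src m -> l = m.

Lemma line_vtx_hereditary : hereditary line_vtx.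
Proof.
move=> l h a b ra rb dab.
have la : src l = rng a by rewrite ra.
have lb : src l = rng b by rewrite rb.
have [|||| _ //] := @comp_inj _ L l a l b => //.
apply: h; rewrite ?rng_comp// ?src_comp// !deg_comp//.
by case: dab => ->; [left|right].
Qed.

Lemma line_vtx_atom v n : line_vtx v -> aperiodic_atom (tal_gen L v n).
Proof.
move=> lv; split; [split; first exact: tal_gen_neq0|split].
- move=> [_ [g [g0]]]; rewrite tal_shift_gen => /tal_piP/tal_eqv_expand h.
  have [N] := far_ex (farI (fun N p q => conj p q) h
    (farI (fun N p q => conj p q) (far_ge n) (far_ge (n + g)))).
  rewrite !expand1 => -[/perm_mem h1 [le1 le2]].
  have [l lP] := pathl_ex v (map_mx absz (N - (n + g))).
  have [rl dl] := pathlP L_rf _ _ _ lP.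
  have := h1 (src l); rewrite map_f// => /esym/mapP[m /pathlP[]// rm dm e].
  have lm := lv _ _ rl rm (or_intror e); move: dl; rewrite lm dm => e'.
  apply: g0; apply: (addrI n); rewrite addr0.
  apply: (addIr (map_mx Posz (map_mx absz (N - n)))).
  by rewrite {1}e' -!map_absK.
- by move/tal_unitP/tal_gen_neq0.
move=> b c; elim/tal_piW: b => x; elim/tal_piW: c => y; rewrite -tal_piD.
move=> /tal_piP/tal_eqv_expand/far_ex[N].
rewrite expand_cat expand1 => /perm_size; rewrite size_cat size_map => e.
have s1 : (size (pathl v (map_mx absz (N - n))) <= 1)%N.
  case E : (pathl v _) => [|l [|m s]]//.
  have := pathl_uniq v (map_mx absz (N - n)); rewrite E /= inE negb_or.
  suff -> : l = m by rewrite eqxx.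
  have /(pathlP L_rf)[rl dl] : l \in pathl v (map_mx absz (N - n)).
    by rewrite E inE eqxx.
  have /(pathlP L_rf)[rm dm] : m \in pathl v (map_mx absz (N - n)).
    by rewrite E !inE eqxx orbT.
  by apply: lv => //; left; rewrite dl dm.
move: s1; rewrite e; case ex : (expand N x) => [|? ?]; first left.
  by rewrite (expand_eq0 ex); apply/tal_unitP.
case ey : (expand N y) => [|? ?]; first right.
  by rewrite (expand_eq0 ey); apply/tal_unitP.
by rewrite /= addnS.
Qed.

Lemma atom_line_vtx v n : aperiodic_atom (tal_gen L v n) -> line_vtx v.
Proof.
move=> [[_ np] [_ at_v]].
have dinj l m : rng l = v -> rng m = v -> deg l = deg m -> l = m.
  move=> rl rm dlm; apply: contrapT => lm.
  have ml : m != l by apply/eqP=> /esym.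
  have := tal_gen_expand v n (deg l).
  have lv : l \in pathl v (deg l) by apply/pathlP.
  have mv : m \in pathl v (deg l) by apply/pathlP.
  rewrite (bigD1_seq l) ?pathl_uniq//= => /at_v[] /tal_unitP.
    exact: tal_gen_neq0.
  rewrite -big_filter (bigD1_seq m) ?mem_filter ?ml ?filter_uniq ?pathl_uniq//=.
  move=> /esym e.
  have /tal_unitP/tal_gen_neq0// :
    is_unit (tal_gen L (src m) (n + map_mx Posz (deg l))).
  by eexists; exact: e.
move=> l m rl rm [|slm]; first exact: dinj.
apply: (dinj) => //; apply: contrapT => dlm; apply: np.
split; first exact: tal_gen_neq0.
have e a : rng a = v ->
    tal_gen L v n = tal_gen L (src a) (n + map_mx Posz (deg a)).
  move=> ra; have av : a \in pathl v (deg a) by apply/pathlP.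
  rewrite (tal_gen_expand v n (deg a)) (bigD1_seq a) ?pathl_uniq//=.
  rewrite big_seq_cond big1 ?addr0// => b /andP[/pathlP[]// rb db].
  by rewrite (dinj _ _ rb ra db) eqxx.
exists (map_mx Posz (deg l) - map_mx Posz (deg m)); split.
  by move/eqP; rewrite subr_eq0 => /eqP/map_Posz_inj.
by rewrite {1}(e m)// tal_shift_gen addrACA subrr addr0 -slm -e.
Qed.

Lemma aperiodic_atomP v n : aperiodic_atom (tal_gen L v n) <-> line_vtx v.
Proof. by split; [exact: atom_line_vtx|exact: line_vtx_atom]. Qed.

Lemma aperiodic_atom_gen (a : talented L) : aperiodic_atom a ->
  exists v n, a = tal_gen L v n.
Proof.
elim/tal_piW: a => -[|[v n] x] [[a0 _] [_ at_a]]; first by case: a0.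
exists v, n; move: at_a; rewrite -cat1s tal_piD => /(_ _ _ erefl)[] /tal_unitP.
  by move/tal_gen_neq0.
by move=> ->; rewrite addr0.
Qed.

(** The elements whose developments end in line vertices. They form an order
    ideal, which contains the one generated by the aperiodic atoms. *)
Definition lineal (a : talented L) : Prop :=
  far (fun N => forall u, u \in expand N (repr a) -> line_vtx u).

Lemma lineal_pi x :
  lineal (tal_pi x) <-> far (fun N => forall u, u \in expand N x -> line_vtx u).
Proof.
have /tal_piP/tal_eqv_expand e := tal_reprK (tal_pi x).
split=> h; apply: farI e h => N /perm_mem e h u; first by rewrite -e => /h.
by rewrite e => /h.
Qed.

Lemma lineal_order_ideal : order_ideal lineal.
Proof.
split.
- by apply/(lineal_pi [::]); apply: farW.
- elim/tal_piW=> x; elim/tal_piW=> y /lineal_pi hx /lineal_pi hy.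
  rewrite -tal_piD; apply/lineal_pi; apply: farI hx hy => N h1 h2 u.
  by rewrite expand_cat mem_cat => /orP[/h1|/h2].
- move=> n; elim/tal_piW=> x /lineal_pi[N0 h]; rewrite tal_shift_pi.
  apply/lineal_pi; exists (N0 + n) => N le_N u.
  have -> : expand N (word_shift n x) = expand (N - n) x.
    rewrite /expand /word_shift -map_comp; congr flatten; apply/eq_map => g /=.
    by rewrite opprD addrCA addrC.
  by apply: h => i; rewrite !mxE lerBrDr; have := le_N i; rewrite mxE.
- elim/tal_piW=> x; elim/tal_piW=> y [z]; elim/tal_piW: z => z.
  rewrite -tal_piD => /tal_piP/tal_eqv_expand e /lineal_pi h; apply/lineal_pi.
  apply: farI e h => N /perm_mem e h u ux; apply: h.
  by rewrite e expand_cat mem_cat ux.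
Qed.

Lemma aperiodic_idealE (a : talented L) : aperiodic_ideal a -> lineal a.
Proof.
apply; split; first exact: lineal_order_ideal.
move=> b hb; have [v [n e]] := aperiodic_atom_gen hb.
move: hb; rewrite e => /aperiodic_atomP lv; apply/lineal_pi.
apply: farW => N u; rewrite expand1 => /mapP[a' /pathlP[]// ra da ->].
by apply: line_vtx_hereditary; rewrite ra.
Qed.

Lemma aperiodic_order_ideal : order_ideal (@aperiodic_ideal k L).
Proof.
split.
- by move=> J [hJ _]; apply: order_ideal0.
- move=> x y hx hy J hJ; have [? _] := hJ.
  by apply: order_idealD => //; [exact: hx|exact: hy].
- move=> n x hx J hJ; have [? _] := hJ.
  by apply: order_ideal_shift => //; exact: hx.
- move=> x y xy hy J hJ; have [oJ _] := hJ.
  exact: order_ideal_le oJ _ _ xy (hy J hJ).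
Qed.

Lemma aperiodic_ideal_sum (I : eqType) (s : seq I) (F : I -> talented L) :
  (forall i, i \in s -> aperiodic_ideal (F i)) ->
  aperiodic_ideal (\sum_(i <- s) F i).
Proof.
move=> h; rewrite big_seq; elim/big_ind: _ => //.
  exact: order_ideal0 aperiodic_order_ideal.
exact: order_idealD aperiodic_order_ideal.
Qed.

Lemma aperiodic_vtxP v : aperiodic_vtx L v <->
  exists n, forall l, rng l = v -> deg l = n -> line_vtx (src l).
Proof.
split=> [/aperiodic_idealE/lineal_pi h|[n h]].
  have [N [/=]] := far_ex (farI (fun N p q => conj p q) h (far_ge 0)).
  rewrite expand1 subr0 => hN N0; exists (map_mx absz N) => l rl dl.
  by apply: hN; apply/map_f/pathlP.
rewrite /aperiodic_vtx /= (tal_gen_expand v 0 n).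
apply: aperiodic_ideal_sum => l /pathlP[]// rl dl J [_]; apply.
exact/line_vtx_atom/h.
Qed.

Lemma line_vtx_aperiodic v : line_vtx v -> aperiodic_vtx L v.
Proof.
move=> lv; apply/aperiodic_vtxP; exists 0 => l rl _.
by apply: line_vtx_hereditary; rewrite rl.
Qed.

Lemma aperiodic_vtx_hereditary : hereditary (aperiodic_vtx L).
Proof.
move=> l rl; have := tal_gen_le_path 0 (erefl (rng l)).
move=> /(order_ideal_le aperiodic_order_ideal)/(_ rl).
move/(order_ideal_shift aperiodic_order_ideal (- (0 + map_mx Posz (deg l)))).
by rewrite tal_shift_gen subrr.
Qed.

Lemma aperiodic_vtx_saturated : saturated (aperiodic_vtx L).
Proof.
move=> v n h; rewrite /aperiodic_vtx /= (tal_gen_expand v 0 n).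
apply: aperiodic_ideal_sum => l lv; rewrite -tal_shift_gen.
apply: order_ideal_shift aperiodic_order_ideal _ _ _.
by apply: h; exists l => //; apply/pathlP.
Qed.

Lemma le_gen_line_vtx v w n p : line_vtx w ->
  alg_le (tal_gen L w n) (tal_gen L v p) ->
  exists l, rng l = v /\ line_vtx (src l).
Proof.
move=> lw [z]; elim/tal_piW: z => z; rewrite -tal_piD.
move=> /tal_piP/tal_eqv_expand/far_ex[N /perm_mem].
have [a aP] := pathl_ex w (map_mx absz (N - n)).
move=> /(_ (src a)); rewrite expand_cat !expand1 mem_cat.
rewrite (map_f (@src _ L) aP) /= => /mapP.
move=> [l /pathlP[]// rl _ e]; exists l; split=> //; rewrite -e.
by apply: line_vtx_hereditary; have [-> _] := pathlP L_rf _ _ _ aP.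
Qed.

End Talented.

(** * The twisted infinite path representation *)

Section Representation.
Variables (k : nat) (L : kgraph k) (K : fieldType) (B : nat).
Hypotheses (L_rf : row_finite L) (L_ns : no_sources L).
Implicit Types (l m : L) (v : vtx L) (x y : 'rV[nat]_k -> L).

Local Notation W := {fraction {poly K}}.
Local Notation X := (tofrac 'X : W).
Local Notation F := (('rV[nat]_k -> L) -> W).
Implicit Types (h : F).

Let X_neq0 : X != 0. Proof. by rewrite tofrac_eq0 polyX_eq0. Qed.

(** The twist: a path of degree [n] shifts the [Z]-grading of the Laurent
    polynomials by [wdeg B n]. *)
Definition twist (n : 'rV[nat]_k) : W := X ^+ wdeg B n.

Lemma twist_neq0 (n : 'rV[nat]_k) : twist n != 0. Proof. exact: expf_neq0. Qed.
Lemma twistD (m n : 'rV[nat]_k) : twist (m + n) = twist m * twist n.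
Proof. by rewrite /twist wdegD exprD. Qed.
Lemma twist0 : twist 0 = 1. Proof. by rewrite /twist wdeg0. Qed.

Lemma twist_eq (m n : 'rV[nat]_k) : twist m = twist n -> wdeg B m = wdeg B n.
Proof.
rewrite /twist -!tofracXn => /eqP; rewrite tofrac_eq => /eqP e.
by have := congr1 (fun q : {poly K} => size q) e; rewrite /= !size_polyXn => -[].
Qed.

(** The operators of the vertices, of the paths and of the ghost paths. They
    vanish on the arguments that are not infinite paths. *)
Definition act_p v h : F := fun x =>
  if pselect (infpath x /\ rng (x 0) = v) then h x else 0.
Definition act_s l h : F := fun x =>
  if pselect (infpath x /\ x (deg l) = l)
  then twist (deg l) * h (ishift (deg l) x) else 0.
Definition act_t l h : F := fun x =>
  if pselect (infpath x /\ src l = rng (x 0))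
  then (twist (deg l))^-1 * h (icat l x) else 0.

(** The action of the terms of the Kumjian-Pask algebra on the functions from
    infinite paths to [K(X)], which is [K(X)]-linear. *)
Fixpoint act_term (a : kp_term L K) h : F :=
  match a with
  | KPp v => act_p v h
  | KPs l => act_s (val l) h
  | KPt l => act_t (val l) h
  | KPzero => fun=> 0
  | KPadd a b => fun x => act_term a h x + act_term b h x
  | KPscale c a => fun x => tofrac c%:P * act_term a h x
  | KPmul a b => act_term a (act_term b h)
  end.

Lemma act_term_linear a (c : W) h1 h2 :
  act_term a (fun x => h1 x + c * h2 x) =
  fun x => act_term a h1 x + c * act_term a h2 x.
Proof.
elim: a h1 h2 => [v|l|l||a IHa b IHb|e a IHa|a IHa b IHb] h1 h2 /=;
  rewrite ?IHb ?IHa //; apply/funext=> x.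
- by rewrite /act_p; case: pselect => //= _; rewrite mulr0 addr0.
- rewrite /act_s; case: pselect => /= _; last by rewrite mulr0 addr0.
  by rewrite mulrDr mulrCA.
- rewrite /act_t; case: pselect => /= _; last by rewrite mulr0 addr0.
  by rewrite mulrDr mulrCA.
- by rewrite mulr0 addr0.
- by rewrite mulrDr addrACA.
- by rewrite mulrDr mulrCA.
Qed.

Lemma act_termD a h1 h2 : act_term a (fun x => h1 x + h2 x) =
  fun x => act_term a h1 x + act_term a h2 x.
Proof.
transitivity (act_term a (fun x => h1 x + 1 * h2 x)).
  by congr act_term; apply/funext=> x; rewrite mul1r.
by rewrite act_term_linear; apply/funext=> x; rewrite mul1r.
Qed.

Lemma act_termZ a (c : W) h : act_term a (fun x => c * h x) =
  fun x => c * act_term a h x.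
Proof.
have z : act_term a (fun=> 0) = fun=> 0.
  transitivity (act_term a (fun x => (0 : W) + (-1) * 0)).
    by congr act_term; apply/funext=> x; rewrite mulr0 addr0.
  have := act_term_linear a (-1) (fun=> 0) (fun=> 0); rewrite /= => ->.
  by apply/funext=> x; rewrite mulN1r subrr.
transitivity (act_term a (fun x => 0 + c * h x)).
  by congr act_term; apply/funext=> x; rewrite add0r.
have := act_term_linear a c (fun=> 0) h; rewrite /= => ->.
by apply/funext=> x; rewrite z add0r.
Qed.

Lemma ishift0 x : infpath x -> ishift 0 x = x.
Proof.
move=> xi; rewrite -[RHS](icat_shift xi 0); apply/funext=> n.
have e0 : x 0 = idm (rng (x 0)) by apply/deg0_idm/inf_deg.
have es : src (x 0) = rng (x 0) by rewrite e0 src_idm rng_idm.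
have e : x 0 = idm (rng (ishift 0 x n)) by rewrite -(inf_src xi) es.
by rewrite /icat e comp_idl pfx_full// ishift_deg.
Qed.

Lemma act_s_idm v h : act_s (idm v) h = act_p v h.
Proof.
apply/funext=> x; rewrite /act_s /act_p deg_idm.
case: pselect => /= [[xi x0]|nx]; case: pselect => //= -[].
- by rewrite ishift0// twist0 mul1r.
- by split=> //; rewrite x0 rng_idm.
- by move=> xi rx; case: nx; split=> //; rewrite -rx; apply/deg0_idm/inf_deg.
Qed.

Lemma act_t_idm v h : act_t (idm v) h = act_p v h.
Proof.
apply/funext=> x; rewrite /act_t /act_p deg_idm src_idm twist0 invr1.
case: pselect => /= [[xi x0]|nx]; case: pselect => //= -[]; last first.
- by move=> xi rx; case: nx.
- by [].
move=> _ _; rewrite mul1r; congr h; apply/funext=> n.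
by rewrite /icat x0 -(inf_rng xi n) comp_idl pfx_full// inf_deg.
Qed.

Lemma act_term_s l h : act_term (term_s K l) h = act_s l h.
Proof.
rewrite /term_s; case: insubP => [l' _ <- //|/negPn/eqP/deg0_idm {2}->] /=.
by rewrite act_s_idm.
Qed.

Lemma act_term_t l h : act_term (term_t K l) h = act_t l h.
Proof.
rewrite /term_t; case: insubP => [l' _ <- //|/negPn/eqP/deg0_idm {2}->] /=.
by rewrite act_t_idm.
Qed.

Lemma act_term_sum I (r : seq I) (f : I -> kp_term L K) h x :
  act_term (\big[@KPadd k L K/@KPzero k L K]_(i <- r) f i) h x =
  \sum_(i <- r) act_term (f i) h x.
Proof.
by elim: r => [|i r IH]; rewrite ?big_nil// !big_cons /= IH.
Qed.

Lemma act_term_eqv a b : kp_eqv a b -> forall h, act_term a h = act_term b h.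
Proof.
elim=> {a b}.
- by [].
- by move=> a b _ e h; rewrite e.
- by move=> a b c _ e1 _ e2 h; rewrite e1 e2.
- by move=> a a' b b' _ e1 _ e2 h; rewrite /= e1 e2.
- by move=> c a a' _ e h; rewrite /= e.
- by move=> a a' b b' _ e1 _ e2 h; rewrite /= e1 e2.
- by move=> a b c h; apply/funext=> x; rewrite /= addrA.
- by move=> a b h; apply/funext=> x; rewrite /= addrC.
- by move=> a h; apply/funext=> x; rewrite /= add0r.
- move=> a h; apply/funext=> x.
  by rewrite /= polyCN tofracN tofrac1 mulN1r addNr.
- by move=> c d a h; apply/funext=> x; rewrite /= mulrA -tofracM -polyCM.
- by move=> a h; apply/funext=> x; rewrite /= tofrac1 mul1r.
- by move=> c a b h; apply/funext=> x; rewrite /= mulrDr.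
- by move=> c d a h; apply/funext=> x; rewrite /= polyCD tofracD mulrDl.
- by [].
- by [].
- by move=> a b c h; rewrite /= act_termD.
- by [].
- by move=> c a b h; rewrite /= act_termZ.
- move=> u v h; apply/funext=> x; rewrite /= /act_p.
  case: eqP => [<-|uv] /=; first by rewrite /act_p; case: pselect.
  case: pselect => //= -[xi xu]; case: pselect => //= -[_ xv].
  by case: uv; rewrite -xu.
- move=> l m lm h; rewrite /= !act_term_s; apply/funext=> x; rewrite /act_s.
  case: pselect => /= [[xi xl]|nx].
    have e : ishift (deg m) (ishift (deg l) x) = ishift (deg (comp l m)) x.
      by rewrite ishiftD// deg_comp.
    case: pselect => /= [[yi ym]|ny]; case: pselect => /= [[_ xlm]|nx].
    + by rewrite e deg_comp// twistD mulrA.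
    + by case: nx; split=> //; rewrite deg_comp// inf_split// xl ym.
    + case: ny; split; first exact: infpath_shift.
      have s : src (x (deg l)) = rng (ishift (deg l) x (deg m)) by exact: inf_src.
      move: xlm; rewrite deg_comp// inf_split//.
      by case/comp_inj => //; rewrite inf_deg.
    + by rewrite mulr0.
  case: pselect => //= -[xi xlm]; case: nx; split=> //.
  move: xlm; rewrite deg_comp// => xlm.
  by rewrite -(inf_pfx xi _ (deg m)) xlm pfx_comp.
- move=> l m lm h; rewrite /= !act_term_t; apply/funext=> x; rewrite /act_t.
  rewrite (src_comp lm).
  case: pselect => /= [[xi mx]|//].
  have yi : infpath (icat m x) by exact: infpath_cat.
  case: pselect => /= [[_ ly]|[]]; last by split=> //; rewrite icat_rng.
  by rewrite icatD// deg_comp// twistD invfM mulrCA mulrA.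
- move=> l h; rewrite /= !act_term_s; apply/funext=> x; rewrite /act_s /act_p.
  case: pselect => /= [//|nx]; case: pselect => //= -[xi xl]; case: nx.
  by split=> //; rewrite -(inf_rng xi (deg l)) xl.
- move=> l h; rewrite /= !act_term_s; apply/funext=> x; rewrite /act_s /act_p.
  case: pselect => /= [[xi xl]|//]; case: pselect => /= [//|[]].
  by split; [exact: infpath_shift|rewrite ishift_rng// xl].
- move=> l h; rewrite /= !act_term_t; apply/funext=> x; rewrite /act_t /act_p.
  case: pselect => /= [[xi xl]|nx]; case: pselect => //= -[] // xi xl; case: nx.
  by split.
- move=> l h; rewrite /= !act_term_t; apply/funext=> x; rewrite /act_t /act_p.
  case: pselect => /= [[xi xl]|//]; case: pselect => /= [//|[]].
  by split; [exact: infpath_cat|rewrite icat_rng].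
- move=> l m dlm h; rewrite /= act_term_t act_term_s; apply/funext=> x.
  rewrite /act_s /act_t; case: eqP => [<-|lm] /=; rewrite /act_p.
    case: pselect => /= [[xi lx]|nx]; case: pselect => /= [[]|ny] //.
    + rewrite ?icat_pfx// ishift_cat// => _ _; case: pselect => /= [[_ rx]|[]//].
      by rewrite mulKf ?twist_neq0.
    + by case: ny; split; [exact: infpath_cat|exact: icat_pfx].
    by move=> xi rx; case: nx.
  case: pselect => /= [[xi lx]|//].
  case: pselect => /= [[_]|]; last by rewrite mulr0.
  by rewrite -dlm icat_pfx.
- move=> v n h; apply/funext=> x; rewrite act_term_sum.
  rewrite -/(pathl v n).
  have e l : act_term (KPmul (term_s K l) (term_t K l)) h x =
      if pselect (infpath x /\ x (deg l) = l) then h x else 0.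
    rewrite /= act_term_s act_term_t /act_s /act_t; case: pselect => //= -[xi xl].
    case: pselect => /= [_|[]].
      by rewrite mulVKf ?twist_neq0// -{1}xl icat_shift.
    by split; [exact: infpath_shift|rewrite ishift_rng// xl].
  under eq_bigr do rewrite e.
  rewrite /= /act_p.
  case: pselect => /= [[xi rx]|nx].
    have xn : x n \in pathl v n.
      by apply/pathlP => //; rewrite inf_rng// inf_deg.
    rewrite (bigD1_seq (x n)) ?pathl_uniq//= big_seq_cond big1 ?addr0.
      by case: pselect => //= -[]; rewrite inf_deg.
    move=> l /andP[/pathlP[]// rl dl lx]; case: pselect => //= -[_].
    by rewrite dl => xl; rewrite xl eqxx in lx.
  rewrite big_seq big1// => l /pathlP[]// rl dl; case: pselect => //= -[xi xl].
  by case: nx; split=> //; rewrite -(inf_rng xi (deg l)) xl.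
Qed.

Definition act (a : KP L K) : F -> F := act_term (repr a).

Lemma act_pi a h : act (kp_pi a) h = act_term a h.
Proof. exact/act_term_eqv/kp_repr_eqv. Qed.

Lemma actD a b h x : act (a + b) h x = act a h x + act b h x.
Proof.
by elim/kp_piW: a => a; elim/kp_piW: b => b; rewrite -kp_piD !act_pi.
Qed.

Lemma actZ c a h x : act (c *: a) h x = tofrac c%:P * act a h x.
Proof. by elim/kp_piW: a => a; rewrite -kp_piZ !act_pi. Qed.

Lemma actM a b h : act (a ** b) h = act a (act b h).
Proof.
by elim/kp_piW: a => a; elim/kp_piW: b => b; rewrite -kp_piM !act_pi.
Qed.

Lemma act0 h x : act 0 h x = 0.
Proof. by have := actZ 0 0 h x; rewrite scale0r polyC0 tofrac0 mul0r. Qed.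

Lemma act_sum I (r : seq I) (f : I -> KP L K) h x :
  act (\sum_(i <- r) f i) h x = \sum_(i <- r) act (f i) h x.
Proof.
by elim: r => [|i r IH]; rewrite ?big_nil ?act0// !big_cons actD IH.
Qed.

Lemma act_hom a (c : W) h : act a (fun x => c * h x) = fun x => c * act a h x.
Proof. exact: act_termZ. Qed.

(** The indicator function of an infinite path. *)
Definition delta x : F := fun y => if pselect (y = x) then 1 else 0.

Lemma act_s_delta l y : infpath y -> src l = rng (y 0) ->
  act (kp_s K l) (delta y) = fun x => twist (deg l) * delta (icat l y) x.
Proof.
move=> yi ly; rewrite act_pi act_term_s; apply/funext=> x; rewrite /act_s /delta.
case: pselect => /= [[xi xl]|nx]; case: pselect => /= [e|ne] //=.
- by case: pselect => //= -[]; rewrite -e -{1}xl icat_shift.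
- by case: pselect => //= e; case: ne; rewrite e ishift_cat.
- by case: nx; rewrite e; split; [exact: infpath_cat|exact: icat_pfx].
by rewrite mulr0.
Qed.

Lemma act_t_delta l y : infpath y -> src l = rng (y 0) ->
  act (kp_t K l) (delta (icat l y)) = fun x => (twist (deg l))^-1 * delta y x.
Proof.
move=> yi ly; rewrite act_pi act_term_t; apply/funext=> x; rewrite /act_t /delta.
case: pselect => /= [[xi xl]|nx]; case: pselect => /= [e|ne] //=.
- case: pselect => //= -[].
  by rewrite -(ishift_cat xi xl) e ishift_cat.
- by case: pselect => //= e; case: ne; rewrite e.
- by case: nx; rewrite e.
by rewrite mulr0.
Qed.

Lemma act_p_delta v y : infpath y -> rng (y 0) = v ->
  act (kp_p K v) (delta y) = delta y.
Proof.
move=> yi yv; rewrite act_pi; apply/funext=> x; rewrite /= /act_p /delta.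
case: pselect => /= [[xi xl]|nx]//; case: pselect => //= e.
by case: nx; rewrite e.
Qed.

Lemma act_ts_delta l m y : infpath y -> src l = rng (y 0) ->
  src m = rng (y 0) -> icat l y = icat m y ->
  act (kp_t K l ** kp_s K m) (delta y) =
  fun x => twist (deg m) / twist (deg l) * delta y x.
Proof.
move=> yi ly my e; rewrite actM act_s_delta// act_hom -e act_t_delta//.
by apply/funext=> x; rewrite mulrA.
Qed.

(** The operators preserve the functions with values in Laurent polynomials of
    bounded order. *)
Definition laurent h : Prop :=
  exists N, forall x, exists q : {poly K}, X ^+ N * h x = tofrac q.

Lemma laurent_act_term a h : laurent h -> laurent (act_term a h).
Proof.
have cancel_unit (R : fieldType) (b c d : R) :
    b != 0 -> b * c * (b^-1 * d) = c * d.
  by move=> b0; rewrite mulrACA mulfV// mul1r.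
elim: a h => [v|l|l||a IHa b IHb|c a IHa|a IHa b IHb] h hh /=.
- case: hh => N hN; exists N => x; rewrite /act_p; case: pselect => //= _.
  by exists 0; rewrite mulr0 tofrac0.
- case: hh => N hN; exists N => x; rewrite /act_s.
  case: pselect => /= _; last first.
    by exists 0; rewrite mulr0 tofrac0.
  have [q e] := hN (ishift (deg (val l)) x).
  exists ('X ^+ wdeg B (deg (val l)) * q).
  by rewrite mulrCA e tofracM tofracXn.
- case: hh => N hN; exists (wdeg B (deg (val l)) + N)%N => x.
  rewrite /act_t; case: pselect => /= _; last by exists 0; rewrite mulr0 tofrac0.
  have [q e] := hN (icat (val l) x); exists q.
  rewrite -e exprD; apply: cancel_unit; exact: expf_neq0.
- by exists 0 => x; exists 0; rewrite mulr0 tofrac0.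
- have [N hN] := IHa _ hh; have [N' hN'] := IHb _ hh; exists (N + N')%N => x.
  have [q e] := hN x; have [q' e'] := hN' x.
  exists ('X ^+ N' * q + 'X ^+ N * q').
  rewrite tofracD !tofracM !tofracXn -e -e' -/X exprD mulrDr.
  by congr (_ + _); rewrite !mulrA// [X ^+ N' * _]mulrC.
- have [N hN] := IHa _ hh; exists N => x; have [q e] := hN x.
  by exists (c%:P * q); rewrite mulrCA e tofracM.
- exact/IHa/IHb.
Qed.

Lemma laurent_delta x : laurent (delta x).
Proof.
exists 0 => y; rewrite /delta; case: pselect => /= _.
  by exists 1; rewrite mul1r tofrac1.
by exists 0; rewrite mulr0 tofrac0.
Qed.

(** If [z] acts on [delta x] by a nonzero scalar and [V] by a monomial of
    nonzero degree, then [z] is not in the left ideal generated by [z - V ** z]: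
    the coefficient of [a] at [x] would be an inverse of [1 - X^i / X^j] among
    Laurent polynomials, but the latter vanishes at [X = 1]. *)
Lemma monomial_noninvertible (a z V : KP L K) x (f : W) (m n : 'rV[nat]_k) :
  f != 0 -> act z (delta x) = (fun y => f * delta x y) ->
  act V (delta x) = (fun y => twist m / twist n * delta x y) ->
  wdeg B m <> wdeg B n -> a ** (z - V ** z) <> z.
Proof.
move=> f0 zx Vx mn e.
have ux : act (z - V ** z) (delta x) =
    fun y => f * (1 - twist m / twist n) * delta x y.
  apply/funext=> y; rewrite actD -scaleN1r actZ polyCN tofracN tofrac1 mulN1r.
  rewrite actM zx act_hom Vx mulrBr mulr1 mulrBl; congr (_ - _).
  by rewrite mulrA.
have dxx : delta x x = 1 by rewrite /delta; case: pselect.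
have := congr1 (fun b => act b (delta x) x) e.
rewrite /= actM ux act_hom zx dxx mulr1 -mulrA -[RHS]mulr1 => /(mulfI f0).
have [N] := laurent_act_term (repr a) (laurent_delta x).
move=> /(_ x)[q]; rewrite -/(act a _ _) => eq e1.
have e2 : ('X ^+ wdeg B n - 'X ^+ wdeg B m) * q = 'X ^+ (wdeg B n + N).
  apply/eqP; rewrite -tofrac_eq tofracM tofracB !tofracXn -eq -/X -/(twist n).
  rewrite -/(twist m) exprD -/(twist n) -[X in _ == _ * X]mulr1 -e1.
  rewrite [X ^+ N * (_ * _)]mulrCA !mulrA; apply/eqP; congr (_ * _ * _).
  by rewrite mulrBr mulr1 mulrCA mulfV ?twist_neq0// mulr1.
have := congr1 (fun p => p.[1]) e2.
by rewrite hornerM hornerD hornerN !hornerXn !expr1n subrr mul0r => /eqP;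
  rewrite eq_sym oner_eq0.
Qed.

Lemma kp_p_neq0 v : kp_p K v <> 0.
Proof.
have [x xi xv] := infpath_ex L_ns v => e.
have := congr1 (fun b => act b (delta x) x) e.
rewrite /= act_p_delta// act0 /delta; case: pselect => //= _ /eqP.
by rewrite oner_eq0.
Qed.

End Representation.

(** * Minimal left ideals of algebras without unit *)

Section NuAlgebraTheory.
Variables (K : fieldType) (A : nuAlgType K).
Implicit Types (x y a b : A) (J M : set A).

Lemma numul0l x : 0 ** x = 0.
Proof. by have := numulZl 0 0 x; rewrite !scale0r. Qed.
Lemma numul0r x : x ** 0 = 0.
Proof. by have := numulZr 0 x 0; rewrite !scale0r. Qed.

Lemma numul_suml I (r : seq I) (f : I -> A) x :
  (\sum_(i <- r) f i) ** x = \sum_(i <- r) f i ** x.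
Proof.
by elim: r => [|i r IH]; rewrite ?big_nil ?numul0l// !big_cons numulDl IH.
Qed.

Lemma numul_sumr I (r : seq I) (f : I -> A) x :
  x ** (\sum_(i <- r) f i) = \sum_(i <- r) x ** f i.
Proof.
by elim: r => [|i r IH]; rewrite ?big_nil ?numul0r// !big_cons numulDr IH.
Qed.

Lemma subspaceB J x y : subspace J -> J x -> J y -> J (x - y).
Proof.
move=> JS Jx Jy; apply: subspaceD => //; rewrite -scaleN1r; exact: subspaceZ.
Qed.

Lemma left_ideal_left_mul x : left_ideal (left_mul_ideal x).
Proof.
split; first split.
- by exists 0; rewrite // numul0l.
- by move=> _ _ [a _ <-] [b _ <-]; exists (a + b) => //; rewrite numulDl.
- by move=> c _ [a _ <-]; exists (c *: a) => //; rewrite numulZl.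
by move=> b _ [a _ <-]; exists (b ** a) => //; rewrite numulA.
Qed.

Lemma left_mul_sub J x : left_ideal J -> J x -> left_mul_ideal x `<=` J.
Proof. by move=> [_ h] Jx _ [a _ <-]; apply: h. Qed.

(** A nonzero left ideal inside a minimal one contains it. *)
Lemma minimal_le M J x : minimal_left_ideal M -> left_ideal J -> J `<=` M ->
  J x -> x <> 0 -> M `<=` J.
Proof.
move=> [_ _ minM] Jl JM Jx x0; case: (minM J Jl JM) => [J0|->//].
by move: Jx; rewrite J0.
Qed.

Lemma set_neq0P J : J 0 -> J <> [set 0] -> exists2 x, J x & x <> 0.
Proof.
move=> J0 Jn; apply: contrapT => h; apply: Jn; apply/seteqP; split=> x /=.
  by move=> Jx; apply: contrapT => x0; apply: h; exists x.
by move=> ->.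
Qed.

(** Right multiplication kills a minimal left ideal or maps it onto another
    one. *)
Lemma minimal_mulr M b : minimal_left_ideal M ->
  (forall m, M m -> m ** b = 0) \/ minimal_left_ideal [set m ** b | m in M].
Proof.
move=> Mmin; have [[MS ML] _ minM] := Mmin.
have [h|] := pselect (forall m, M m -> m ** b = 0); first by left.
move=> /existsNP[m /not_implyP[Mm mb0]].
right; split.
- split; first split.
  + by exists 0; [exact: subspace0|rewrite numul0l].
  + move=> _ _ [x Mx <-] [y My <-]; exists (x + y); last by rewrite numulDl.
    exact: subspaceD.
  + move=> c _ [x Mx <-]; exists (c *: x); last by rewrite numulZl.
    exact: subspaceZ.
  by move=> a _ [x Mx <-]; exists (a ** x); [exact: ML|rewrite numulA].
- move=> e; apply: mb0; have : [set m ** b | m in M] (m ** b) by exists m.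
  by rewrite e.
move=> J [JS JL] JMb.
pose J' := [set x | M x /\ J (x ** b)].
have J'l : left_ideal J'.
  split; first split.
  - by split; [exact: subspace0|rewrite numul0l; exact: subspace0].
  - move=> x y [Mx Jx] [My Jy]; split; first exact: subspaceD.
    by rewrite numulDl; exact: subspaceD.
  - move=> c x [Mx Jx]; split; first exact: subspaceZ.
    by rewrite numulZl; exact: subspaceZ.
  by move=> a x [Mx Jx]; split; [exact: ML|rewrite -numulA; exact: JL].
have J'M : J' `<=` M by move=> x [].
case: (minM J' J'l J'M) => e; [left|right]; apply/seteqP; split=> y.
- move=> Jy; have [x Mx xy] := JMb y Jy.
  have : J' x by split=> //; rewrite xy.
  by rewrite e /= => x0; rewrite -xy x0 numul0l.
- by move=> ->; exact: subspace0.
- exact: JMb.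
- case=> x Mx <-; have [] : J' x by rewrite e.
  by [].
Qed.

Lemma minimal_ideal M : minimal_left_ideal M -> left_ideal M.
Proof. by case. Qed.

Lemma ideal_gen_ideal (S : set A) : ideal (ideal_gen S).
Proof.
split; first split; first split.
- by move=> I [[[? _] _] _]; exact: subspace0.
- move=> x y hx hy I hI; have [[[IS _] _] _] := hI.
  by apply: subspaceD => //; [exact: hx|exact: hy].
- move=> c x hx I hI; have [[[IS _] _] _] := hI.
  by apply: subspaceZ => //; exact: hx.
- by move=> a x hx I hI; have [[[_ IL] _] _] := hI; apply: IL; exact: hx.
- by move=> a x hx I hI; have [[_ IR] _] := hI; apply: IR; exact: hx.
Qed.

Lemma sub_ideal_gen (S : set A) : S `<=` ideal_gen S.
Proof. by move=> x Sx I [_]; apply. Qed.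

Lemma minimal_socle M : minimal_left_ideal M -> M `<=` socle A.
Proof.
move=> Mmin x Mx; exists [:: x]; rewrite big_seq1; split=> // y.
by rewrite inE => /eqP ->; exists M.
Qed.

Lemma socle_ideal : ideal (socle A).
Proof.
have S0 : socle A 0 by exists [::]; rewrite big_nil; split.
have SD x y : socle A x -> socle A y -> socle A (x + y).
  move=> [r [hr ->]] [r' [hr' ->]]; exists (r ++ r'); rewrite big_cat; split=> //.
  by move=> z; rewrite mem_cat => /orP[/hr|/hr'].
have Ssum (r : seq A) f : (forall y, y \in r -> socle A (f y)) ->
    socle A (\sum_(y <- r) f y).
  by move=> h; rewrite big_seq; elim/big_ind: _.
split; first split; first split => //.
- move=> c _ [r [hr ->]]; rewrite scaler_sumr; apply: (Ssum) => y /hr[M Mm My].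
  by apply: (minimal_socle Mm); have [[MS _] _ _] := Mm; exact: subspaceZ.
- move=> a _ [r [hr ->]]; rewrite numul_sumr; apply: (Ssum) => y /hr[M Mm My].
  by apply: (minimal_socle Mm); have [[_ ML] _ _] := Mm; exact: ML.
move=> a _ [r [hr ->]]; rewrite numul_suml; apply: (Ssum) => y /hr[M Mm My].
have [h|h] := minimal_mulr a Mm; first by rewrite h.
by apply: (minimal_socle h); exists y.
Qed.

End NuAlgebraTheory.

(** * Normal forms in the Kumjian-Pask algebra *)

Section KPTheory.
Variables (k : nat) (L : kgraph k) (K : fieldType).
Hypotheses (L_rf : row_finite L) (L_ns : no_sources L).
Implicit Types (l m : L) (u v w : vtx L) (n r : 'rV[nat]_k).
Implicit Types (x y z : KP L K) (H : set (vtx L)).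

Local Notation p := (kp_p K).
Local Notation s := (kp_s K).
Local Notation t := (kp_t K).
Let F := kp_family_KP L K.

Lemma kp_ts l : t l ** s l = p (src l).
Proof. by rewrite (kpf3 F)// eqxx. Qed.

Lemma kp_ts0 l m : deg l = deg m -> l <> m -> t l ** s m = 0.
Proof. by move=> d lm; rewrite (kpf3 F)//; case: eqP. Qed.

Lemma kp_ts_pfx l m n : deg m = deg l + n ->
  t l ** s m = if pfx m (deg l) == l then s (sfx m (deg l)) else 0.
Proof.
move=> dm; have pm := pfx_sfx dm.
rewrite -{1}(comp_pfx_sfx dm) -(kpf2_ss F pm) numulA.
rewrite (kpf3 F) ?(deg_pfx dm)// eq_sym; case: eqP => [e|_]; last exact: numul0l.
by rewrite -{1}e pm (kpf2_ps F).
Qed.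

Lemma kp_ts_sfx l m n : deg m = deg l + n ->
  t m ** s l = if pfx m (deg l) == l then t (sfx m (deg l)) else 0.
Proof.
move=> dm; have pm := pfx_sfx dm.
rewrite -{1}(comp_pfx_sfx dm) -(kpf2_tt F pm) -numulA.
rewrite (kpf3 F) ?(deg_pfx dm)//; case: eqP => [e|_]; last exact: numul0r.
by rewrite pm (kpf2_tp F).
Qed.

Lemma kp_st_expand l m n : src l = src m ->
  s l ** t m = \sum_(a <- pathl (src l) n) s (comp l a) ** t (comp m a).
Proof.
move=> lm; rewrite -{1}(kpf2_sp F l) (kpf4 F _ n) -/(pathl _ n).
rewrite numul_sumr numul_suml [LHS]big_seq [RHS]big_seq.
apply: eq_bigr => a /pathlP[]// ra _.
by rewrite !numulA (kpf2_ss F)// -numulA (kpf2_tt F)// -lm.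
Qed.

Lemma kp_ts_expand l m n : t l ** s m =
  \sum_(a <- pathl (rng l) n) (t l ** s a) ** (t a ** s m).
Proof.
rewrite -{1}(kpf2_tp F l) (kpf4 F _ n) -/(pathl _ n).
by rewrite numul_sumr numul_suml; apply: eq_bigr => a _; rewrite !numulA.
Qed.

(** Two paths with [t l ** s m] nonzero have a common extension. *)
Lemma kp_ts_neq0 l m : t l ** s m <> 0 ->
  exists a, [/\ deg a = deg l + deg m, pfx a (deg l) = l & pfx a (deg m) = m].
Proof.
move=> lm; apply: contrapT => h; apply: lm.
rewrite (kp_ts_expand l m (deg l + deg m)) big_seq big1// => a /pathlP[]// _ da.
rewrite (kp_ts_pfx da); case: eqP => [al|_]; last exact: numul0l.
rewrite addrC in da; rewrite (kp_ts_sfx da); case: eqP => [am|_].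
  by case: h; exists a; rewrite da addrC.
exact: numul0r.
Qed.

(** The span of the [s l ** t m] with [src l = src m] in [H]. *)
Definition spanned H x : Prop := exists c : seq (K * (L * L)),
  (forall a, a \in c -> src a.2.1 = src a.2.2 /\ H (src a.2.2)) /\
  x = \sum_(a <- c) a.1 *: (s a.2.1 ** t a.2.2).

Lemma spanned_subspace H : subspace (spanned H).
Proof.
split.
- by exists [::]; rewrite big_nil.
- move=> x y [c [hc ->]] [d [hd ->]]; exists (c ++ d); rewrite big_cat.
  by split=> // a; rewrite mem_cat => /orP[/hc|/hd].
- move=> q x [c [hc ->]]; exists [seq (q * a.1, a.2) | a <- c]; split.
    by move=> _ /mapP[a /hc ha ->].
  by rewrite big_map scaler_sumr; apply: eq_bigr => a _; rewrite scalerA.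
Qed.

Lemma spanned_gen H l m : src l = src m -> H (src m) -> spanned H (s l ** t m).
Proof.
move=> lm Hm; exists [:: (1, (l, m))]; rewrite big_seq1 scale1r; split=> // a.
by rewrite inE => /eqP ->.
Qed.

Lemma spanned_ind H (Q : KP L K -> Prop) : subspace Q ->
  (forall l m, src l = src m -> H (src m) -> Q (s l ** t m)) ->
  forall x, spanned H x -> Q x.
Proof.
move=> QS Qg x [c [hc ->]]; rewrite big_seq; elim/big_ind: _ => //.
- exact: subspace0.
- exact: subspaceD.
- by move=> a /hc[? ?]; apply: subspaceZ => //; apply: Qg.
Qed.

Lemma spanned_ts l m l' m' H : hereditary H ->
  src l = src m -> src l' = src m' -> H (src m) \/ H (src m') ->
  spanned H ((s l ** t m) ** (s l' ** t m')).
Proof.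
move=> Hh lm lm' HH; rewrite numulA -[_ ** s l']numulA.
rewrite (kp_ts_expand m l' (deg m + deg l')) numul_sumr numul_suml big_seq.
elim/big_ind: _ => [||a /pathlP[]// _ da].
- exact: subspace0 (spanned_subspace H).
- exact: subspaceD (spanned_subspace H).
have z0 : spanned H 0 by exact: subspace0 (spanned_subspace H).
rewrite (kp_ts_pfx da); case: eqP => [am|_]; last first.
  by rewrite numul0l numul0r numul0l.
have sm := pfx_sfx da; have sa := src_sfx da.
rewrite am -lm in sm.
rewrite addrC in da; rewrite (kp_ts_sfx da).
case: eqP => [al|_]; last by rewrite !(numul0r, numul0l).
have sm' := pfx_sfx da; have sa' := src_sfx da; rewrite al lm' in sm'.
rewrite numulA (kpf2_ss F)// -numulA (kpf2_tt F)//.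
apply: spanned_gen; rewrite !src_comp// ?sa ?sa'//.
case: HH => HH.
  by rewrite -sa; apply: Hh; rewrite -sm lm.
by rewrite -sa'; apply: Hh; rewrite -sm'.
Qed.

Lemma subspace_mull (J : set (KP L K)) y : subspace J ->
  subspace [set x | J (x ** y)].
Proof.
move=> JS; split=> [|x x' Jx Jx'|c x Jx] /=.
- by rewrite numul0l; exact: subspace0.
- by rewrite numulDl; exact: subspaceD.
- by rewrite numulZl; exact: subspaceZ.
Qed.

Lemma spanned_mul H H' x y : hereditary H -> hereditary H' ->
  spanned H x -> spanned H' y ->
  spanned H (x ** y) /\ spanned H' (x ** y).
Proof.
move=> Hh Hh' hx; elim/(@spanned_ind H') : y / => [|l' m' lm' Hm'].
  have [S S'] := (spanned_subspace H, spanned_subspace H').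
  split=> [|y z [? ?] [? ?]|c y [? ?]].
  - by rewrite numul0r; split; exact: subspace0.
  - by rewrite numulDr; split; exact: subspaceD.
  - by rewrite numulZr; split; exact: subspaceZ.
split; move: x hx.
  apply: spanned_ind => [|l m lm Hm]; last by apply: spanned_ts => //; left.
  exact/subspace_mull/spanned_subspace.
apply: spanned_ind => [|l m lm Hm]; last by apply: spanned_ts => //; right.
exact/subspace_mull/spanned_subspace.
Qed.

Lemma kp_p_st v : p v = s (idm v) ** t (idm v).
Proof. by rewrite (kpf_s0 F) (kpf_t0 F) (kpf1 F) eqxx. Qed.

Lemma spannedT x : spanned setT x.
Proof.
have hT : hereditary (@setT (vtx L)) by [].
have sp v : spanned setT (p v) by rewrite kp_p_st; apply: spanned_gen.
have S := spanned_subspace setT.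
elim/kp_piW: x; elim=> [v|l|l||a ha b hb|c a ha|a ha b hb].
- exact: sp.
- have -> : kp_pi (KPs K l) = s (val l) by rewrite /kp_s /term_s valK.
  rewrite -(kpf2_sp F) -(kpf_t0 F); apply: spanned_gen => //.
  by rewrite src_idm.
- have -> : kp_pi (KPt K l) = t (val l) by rewrite /kp_t /term_t valK.
  rewrite -(kpf2_pt F) -(kpf_s0 F); apply: spanned_gen => //.
  by rewrite src_idm.
- exact: (subspace0 S).
- by rewrite kp_piD; exact: subspaceD.
- by rewrite kp_piZ; exact: subspaceZ.
- by rewrite kp_piM; case: (spanned_mul hT hT ha hb).
Qed.

Lemma spanned_ideal H : hereditary H -> ideal (spanned H).
Proof.
move=> Hh; have hT : hereditary (@setT (vtx L)) by [].
split; first split; first exact: spanned_subspace.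
  by move=> a x hx; case: (spanned_mul hT Hh (spannedT a) hx).
by move=> a x hx; case: (spanned_mul Hh hT hx (spannedT a)).
Qed.

(** The sum of the ranges of the paths that occur in [x] is a left unit. *)
Lemma kp_local_unit x : exists e : KP L K, e ** x = x.
Proof.
have [c [_ ->]] := spannedT x.
pose V := undup [seq rng a.2.1 | a <- c].
exists (\sum_(v <- V) p v); rewrite numul_sumr [LHS]big_seq [RHS]big_seq.
apply: eq_bigr => a ac; rewrite numulZr numulA; congr (_ *: (_ ** _)).
have aV : rng a.2.1 \in V by rewrite mem_undup; apply: map_f.
rewrite numul_suml (bigD1_seq _ aV) ?undup_uniq//= (kpf2_ps F).
rewrite big1 ?addr0// => v va.
by rewrite -(kpf2_ps F a.2.1) numulA (kpf1 F) (negbTE va) numul0l.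
Qed.

Lemma left_mul_self x : left_mul_ideal x x.
Proof. by have [e ex] := kp_local_unit x; exists e. Qed.

(** The ghost paths of an element can all be taken of the same degree. *)
Lemma spanned_level H x : hereditary H -> spanned H x ->
  exists n (c : seq (K * (L * L))), (forall a, a \in c ->
      [/\ src a.2.1 = src a.2.2, H (src a.2.2) & deg a.2.2 = n]) /\
    x = \sum_(a <- c) a.1 *: (s a.2.1 ** t a.2.2).
Proof.
move=> Hh.
pose Q x := exists n, forall r, exists c : seq (K * (L * L)),
  (forall a, a \in c ->
      [/\ src a.2.1 = src a.2.2, H (src a.2.2) & deg a.2.2 = n + r]) /\
    x = \sum_(a <- c) a.1 *: (s a.2.1 ** t a.2.2).
suff : spanned H x -> Q x by move=> h /h[n /(_ 0)]; rewrite addr0; exists n.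
move: x; apply: spanned_ind; first split.
- by exists 0 => r; exists [::]; rewrite big_nil.
- move=> x y [n hn] [n' hn']; exists (n + n') => r.
  have [c [hc ->]] := hn (n' + r); have [d [hd ->]] := hn' (n + r).
  exists (c ++ d); rewrite big_cat; split=> // a.
  rewrite mem_cat => /orP[/hc|/hd] [-> h ->]; split=> //; first by rewrite addrA.
  by rewrite addrA [n' + n]addrC.
- move=> q x [n hn]; exists n => r; have [c [hc ->]] := hn r.
  exists [seq (q * a.1, a.2) | a <- c]; split.
    by move=> _ /mapP[a /hc ha ->].
  by rewrite big_map scaler_sumr; apply: eq_bigr => a _; rewrite scalerA.
move=> l m lm Hm; exists (deg m) => r.
exists [seq (1, (comp l a, comp m a)) | a <- pathl (src l) r]; split.
  move=> _ /mapP[a /pathlP[]// ra da ->] /=.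
  rewrite !src_comp// -?lm// deg_comp -?lm// da; split=> //.
  by apply: Hh; rewrite ra lm.
by rewrite big_map (kp_st_expand r lm); apply: eq_bigr => a _; rewrite scale1r.
Qed.

(** A nonzero element can be multiplied on the right into a nonzero linear
    combination of paths with a common source. *)
Lemma kp_reduction H x : hereditary H -> spanned H x -> x <> 0 ->
  exists m (U : seq L) (c : L -> K) l,
    [/\ H (src m), uniq U, (forall a, a \in U -> src a = src m),
        l \in U /\ c l != 0 &
        x ** s m <> 0 /\ x ** s m = \sum_(a <- U) c a *: s a].
Proof.
move=> Hh /(spanned_level Hh)[n [c [hc ex]]] x0.
pose V := undup [seq a.2.2 | a <- c].
have VP m : m \in V -> H (src m) /\ deg m = n.
  by rewrite mem_undup => /mapP[a /hc[_ ? ?] ->].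
(* The sum of the s m ** t m over [V] is a right unit for [x]. *)
have xV : x = \sum_(m <- V) (x ** s m) ** t m.
  transitivity (x ** \sum_(m <- V) s m ** t m); last first.
    by rewrite numul_sumr; apply: eq_bigr => m _; rewrite numulA.
  rewrite ex numul_suml [LHS]big_seq [RHS]big_seq; apply: eq_bigr => a ac.
  rewrite numulZl -numulA; congr (_ *: (_ ** _)).
  have aV : a.2.2 \in V by rewrite mem_undup; apply: map_f.
  have [_ _ da] := hc _ ac.
  rewrite numul_sumr (bigD1_seq _ aV) ?undup_uniq//= numulA kp_ts (kpf2_pt F).
  rewrite big_seq_cond big1 ?addr0// => m /andP[/VP[_ dm] ma].
  by rewrite numulA kp_ts0 ?numul0l ?da ?dm// => e; rewrite e eqxx in ma.
have [m mV xm] : exists2 m, m \in V & x ** s m <> 0.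
  apply: contrapT => h; apply: x0; rewrite xV big_seq big1// => m mV.
  have -> : x ** s m = 0 by apply: contrapT => ?; apply: h; exists m.
  exact: numul0l.
have [Hm dm] := VP m mV.
(* Only the terms with second path [m] survive; those with the same first path
   are collected. *)
pose U := undup [seq a.2.1 | a <- c & a.2.2 == m].
pose d l := \sum_(a <- c | (a.2.2 == m) && (a.2.1 == l)) a.1.
have e : x ** s m = \sum_(l <- U) d l *: s l.
  transitivity (\sum_(a <- c | a.2.2 == m) a.1 *: s a.2.1).
    rewrite ex numul_suml [RHS]big_mkcond [LHS]big_seq [RHS]big_seq.
    apply: eq_bigr => a /hc[sa _ da]; rewrite numulZl -numulA.
    case: eqP => [am|am]; first by rewrite am kp_ts -am -sa (kpf2_sp F).
    by rewrite kp_ts0 ?numul0r ?scaler0// da dm.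
  transitivity
    (\sum_(a <- c | a.2.2 == m) \sum_(l <- U | a.2.1 == l) a.1 *: s l).
    rewrite -big_filter -[RHS]big_filter [LHS]big_seq [RHS]big_seq.
    apply: eq_bigr => a ac.
    have aU : a.2.1 \in U by rewrite mem_undup; apply: map_f.
    rewrite big_mkcond (bigD1_seq _ aU) ?undup_uniq//= eqxx big1 ?addr0//.
    by move=> l; rewrite eq_sym => /negbTE ->.
  rewrite (exchange_big_dep xpredT)//=; apply: eq_bigr => l _.
  by rewrite /d scaler_suml.
have [l lU dl] : exists2 l, l \in U & d l != 0.
  apply: contrapT => h; apply: xm; rewrite e big_seq big1// => l lU.
  have [->|dl] := eqVneq (d l) 0; first by rewrite scale0r.
  by case: h; exists l.
exists m, U, d, l; split=> //; first exact: undup_uniq.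
move=> l'; rewrite mem_undup => /mapP[a]; rewrite mem_filter.
by move=> /andP[/eqP <- /hc[sa _ _]] ->.
Qed.

(** Distinct paths whose common source is a line vertex have no common
    extension. *)
Lemma kp_ts_line l m : src l = src m -> line_vtx (src m) -> l <> m ->
  t l ** s m = 0.
Proof.
move=> lm hm nlm; have [dlm|dlm] := pselect (deg l = deg m); first exact: kp_ts0.
apply: contrapT => /kp_ts_neq0[a [da al am]]; apply: dlm.
have sl := pfx_sfx da; have sa := src_sfx da; have dl := deg_sfx da.
rewrite addrC in da.
have sm := pfx_sfx da; have sa' := src_sfx da; have dm := deg_sfx da.
rewrite -dm -[RHS]dl; congr deg; apply/esym; apply: hm.
- by rewrite -sl al.
- by rewrite -sm am.
- by right; rewrite sa sa'.
Qed.

End KPTheory.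

(** * Minimal left ideals and line vertices *)

Section Socle.
Variables (k : nat) (L : kgraph k) (K : fieldType).
Hypotheses (L_rf : row_finite L) (L_ns : no_sources L).
Implicit Types (l m : L) (u v w : vtx L) (n r : 'rV[nat]_k).
Implicit Types (x z : KP L K) (H : set (vtx L)).

Local Notation p := (kp_p K).
Local Notation s := (kp_s K).
Local Notation t := (kp_t K).
Let F := kp_family_KP L K.

Let p_neq0 v : p v <> 0. Proof. exact: (kp_p_neq0 0%N L_rf L_ns). Qed.
Let setT_h : hereditary [set: vtx L]. Proof. by []. Qed.

(** An element of a minimal left ideal [J] cannot act on an infinite path by a
    nonzero scalar when another element acts by a monomial of nonzero degree. *)
Lemma minimal_no_monomial (B : nat) (J : set (KP L K)) z (V : KP L K)
    (x : 'rV[nat]_k -> L) f n r :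
  minimal_left_ideal J -> J z -> f != 0 ->
  act B z (delta K x) = (fun y => f * delta K x y) ->
  act B V (delta K x) = (fun y => twist K B n / twist K B r * delta K x y) ->
  wdeg B n <> wdeg B r -> False.
Proof.
move=> Jmin Jz f0 zx Vx nr.
have [[JS JL] _ _] := Jmin.
have Jd : J (z - V ** z) by apply: subspaceB => //; exact: JL.
have d0 : z - V ** z <> 0.
  move/subr0_eq => e; apply: nr; apply: (@twist_eq _ K).
  have := congr1 (fun a => act B a (delta K x) x) e.
  rewrite /= actM// zx act_hom Vx /delta; case: pselect => //= _.
  by rewrite !mulr1 -{1}[f]mulr1 => /(mulfI f0)/esym/divr1_eq.
have := minimal_le Jmin (left_ideal_left_mul _) (left_mul_sub (conj JS JL) Jd).
move=> /(_ _ (left_mul_self L_rf _) d0) /(_ _ Jz)[a _].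
exact: (monomial_noninvertible L_rf f0 zx Vx nr).
Qed.

Lemma sum_mul_s (U : seq L) (c : L -> K) l :
  (forall a, a \in U -> src a = rng l) ->
  (\sum_(a <- U) c a *: s a) ** s l = \sum_(a <- U) c a *: s (comp a l).
Proof.
move=> h; rewrite numul_suml [LHS]big_seq [RHS]big_seq.
by apply: eq_bigr => a aU; rewrite numulZl (kpf2_ss F)// h.
Qed.

(** If all but one of the paths of a linear combination are killed by a
    ghost path, then the latter extracts a vertex. *)
Lemma t_mul_sum (U : seq L) (c : L -> K) l (g : L -> L) : uniq U -> l \in U ->
  (forall a, a \in U -> a <> l -> t (g l) ** s (g a) = 0) ->
  t (g l) ** (\sum_(a <- U) c a *: s (g a)) = c l *: p (src (g l)).
Proof.
move=> Uu lU h; rewrite numul_sumr (bigD1_seq l)//= numulZr kp_ts.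
rewrite big_seq_cond big1 ?addr0// => a /andP[aU /eqP al].
by rewrite numulZr h// scaler0.
Qed.

Lemma kp_p_mul_neq v m : v <> rng m -> p v ** s m = 0.
Proof.
move=> vm; rewrite -(kpf2_ps F m) numulA (kpf1 F).
by case: eqP => // _; rewrite numul0l.
Qed.

Lemma kp_t_sum_line (U : seq L) (c : L -> K) l u : uniq U -> l \in U ->
  (forall a, a \in U -> src a = u) -> line_vtx u ->
  t l ** (\sum_(a <- U) c a *: s a) = c l *: p u.
Proof.
move=> Uu lU Us lu; rewrite (t_mul_sum c (g := id))// => [|a aU al].
  by rewrite Us.
by apply: kp_ts_line => //; rewrite ?Us// => e; apply: al.
Qed.

Lemma line_vtx_minimal v :
  line_vtx v -> minimal_left_ideal (left_mul_ideal (p v)).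
Proof.
move=> lv; split; first exact: left_ideal_left_mul.
  move=> e; have := left_mul_self L_rf (p v); rewrite e /=; exact: p_neq0.
move=> J Jl JM; have [[JS JL] J0] := (Jl, subspace0 Jl.1).
have [->|/(set_neq0P J0)[x Jx x0]] := pselect (J = [set 0]); first by left.
right; apply/seteqP; split=> //; apply: left_mul_sub => //.
have xv : x ** p v = x.
  by have [a _ <-] := JM _ Jx; rewrite -numulA (kpf1 F) eqxx.
have [m [U [c [l [_ Uu Us [lU cl] [xm0 e]]]]]] :=
  kp_reduction L_rf setT_h (spannedT L_rf x) x0.
have rm : v = rng m.
  apply: contrapT => vm; apply: xm0.
  by rewrite -xv -numulA kp_p_mul_neq ?numul0r.
have lm : line_vtx (src m) by apply: line_vtx_hereditary; rewrite -rm.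
have := kp_t_sum_line c Uu lU Us lm; rewrite -e => e1.
have st : s m ** t m = p v.
  rewrite (kpf4 F v (deg m)) -/(pathl _ _).
  have mv : m \in pathl v (deg m) by apply/pathlP.
  rewrite (bigD1_seq m) ?pathl_uniq//= big_seq_cond big1 ?addr0//.
  move=> a /andP[/pathlP[]// ra da /eqP am]; case: am.
  by apply: lv => //; left.
have : J ((c l)^-1 *: (s m ** (t l ** x))).
  by apply: subspaceZ => //; apply/JL/JL.
have -> : t l ** x = c l *: t m.
  by rewrite -{1}xv -st !numulA -[t l ** x ** s m]numulA e1 numulZl (kpf2_pt F).
by rewrite numulZr st scalerA mulVf// scale1r.
Qed.

Lemma minimal_line_vtx v :
  minimal_left_ideal (left_mul_ideal (p v)) -> line_vtx v.
Proof.
move=> Mmin.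
(* The left ideal of [t l] is all of [KP p_v], yet [t l] kills [s m]. *)
have dinj l m : rng l = v -> rng m = v -> deg l = deg m -> l = m.
  move=> rl rm dlm; apply: contrapT => lm.
  have tl : left_mul_ideal (p v) (t l).
    by exists (t l) => //; rewrite -rl (kpf2_tp F).
  have tl0 : t l <> 0.
    by move=> e; apply: (@p_neq0 (src l)); rewrite -kp_ts e numul0l.
  have := minimal_le Mmin (left_ideal_left_mul (t l))
    (left_mul_sub (left_ideal_left_mul _) tl) (left_mul_self L_rf _) tl0.
  move=> /(_ _ (left_mul_self L_rf _))[a _ ea].
  apply: (@p_neq0 (src m)); rewrite -kp_ts -(kpf2_ps F m) rm -ea.
  by rewrite -numulA kp_ts0// !numul0r.
move=> l m rl rm [|slm]; first exact: dinj.
apply: contrapT => lm.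
have dlm : deg l <> deg m by move/(dinj _ _ rl rm).
have [B Binj] := wdeg_separates [:: deg l; deg m].
have [y yi yl] := infpath_ex L_ns (src l).
have ly : src l = rng (y 0) by [].
have my : src m = rng (y 0) by rewrite -slm.
(* [v] emits one infinite path, which [s l ** t m] multiplies by a monomial. *)
have e : icat l y = icat m y.
  have li := infpath_cat yi ly; have mi := infpath_cat yi my.
  apply/funext=> n; apply: dinj.
  - by rewrite inf_rng// icat_rng.
  - by rewrite inf_rng// icat_rng.
  - by rewrite !inf_deg.
apply: (@minimal_no_monomial B _ (p v) (s l ** t m) (icat m y) 1
  (deg l) (deg m) Mmin).
- exact: left_mul_self.
- exact: oner_neq0.
- rewrite act_p_delta//; [|exact: infpath_cat|by rewrite icat_rng].
  by apply/funext=> x; rewrite mul1r.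
- rewrite actM// act_t_delta// act_hom act_s_delta// e; apply/funext=> x.
  by rewrite mulrA [_^-1 * _]mulrC.
- by move/Binj => h; apply: dlm; apply: h; rewrite !inE eqxx ?orbT.
Qed.

(** Paths whose prolongations along [y] always have a common extension have the
    same concatenation with [y]. *)
Lemma icat_common l m (y : 'rV[nat]_k -> L) : infpath y ->
  src l = rng (y 0) -> src m = rng (y 0) ->
  (forall n, t (comp l (y n)) ** s (comp m (y n)) <> 0) -> icat l y = icat m y.
Proof.
move=> yi ly my h; apply/funext=> n.
have [b [db bl bm]] := kp_ts_neq0 L_rf (h n).
have lyn : src l = rng (y n) by rewrite inf_rng.
have myn : src m = rng (y n) by rewrite inf_rng.
have dl : deg (comp l (y n)) = n + deg l.
  by rewrite (deg_comp lyn) (inf_deg yi) addrC.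
have dm : deg (comp m (y n)) = n + deg m.
  by rewrite (deg_comp myn) (inf_deg yi) addrC.
rewrite dl dm in db; rewrite dl in bl; rewrite dm in bm.
rewrite /icat -bl -bm (pfx_pfx db); rewrite addrC in db.
by rewrite (pfx_pfx db).
Qed.

(** Every minimal left ideal meets the ideal of the line vertices: it contains
    a nonzero [x] with [p u ** x = x] for some line vertex [u]. A nonzero element
    is reduced to a linear combination of paths [a] with a common
    source; among its right translates by paths [e] one takes one for which the
    fewest products [t (l e) ** s (a e)] survive. If only the one with [a = l]
    does, the ideal contains a vertex up to right multiplication. Otherwise all
    surviving paths agree on every infinite path, which contradicts
    [minimal_no_monomial]. *)
Lemma minimal_left_ideal_line (M : set (KP L K)) : minimal_left_ideal M ->
  exists u x, [/\ line_vtx u, M x, x <> 0 & p u ** x = x].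
Proof.
move=> Mmin; have [[MS ML] Mn0 _] := Mmin.
have [x Mx x0] := set_neq0P (subspace0 MS) Mn0.
have [m [U [c [l [_ Uu Us [lU cl] [xm0 e]]]]]] :=
  kp_reduction L_rf setT_h (spannedT L_rf x) x0.
pose P g a := `[< t (comp l g) ** s (comp a g) <> 0 >].
have [g rg gmin] : exists2 g, rng g = src m &
    forall b, rng b = src g -> (count (P g) U <= count (P (comp g b)) U)%N.
  pose Q i := `[< exists2 g, rng g = src m & count (P g) U = i >].
  have exQ : exists i, Q i.
    exists (count (P (idm (src m))) U); apply/asboolP.
    by exists (idm (src m)) => //; rewrite rng_idm.
  have [i /asboolP[g rg gi] imin] := ex_minnP exQ.
  exists g => // b rb; rewrite gi; apply: imin; apply/asboolP.
  by exists (comp g b) => //; rewrite rng_comp.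
have ag a : a \in U -> src a = rng g by move=> /Us ->.
have Pstep a b : a \in U -> rng b = src g -> P (comp g b) a -> P g a.
  move=> aU rb /asboolP h; apply/asboolP => z; apply: h.
  have src_ag a' : a' \in U -> src (comp a' g) = rng b.
    by move=> /ag a'g; rewrite src_comp.
  rewrite !Defs.compA ?(ag _ lU) ?(ag _ aU)//.
  rewrite -(kpf2_tt F (src_ag _ lU)) -(kpf2_ss F (src_ag _ aU)).
  by rewrite numulA -[_ ** s (comp a g)]numulA z numul0r numul0l.
have Pstable a b : a \in U -> rng b = src g -> P g a -> P (comp g b) a.
  move=> aU rb Pa.
  have sub : {subset [seq a <- U | P (comp g b) a] <= [seq a <- U | P g a]}.
    move=> a'; rewrite !mem_filter => /andP[h a'U]; rewrite a'U andbT.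
    exact: Pstep h.
  have [|_ /(_ a)] := uniq_min_size (filter_uniq _ Uu) sub.
    by rewrite !size_filter gmin.
  by rewrite !mem_filter aU Pa !andbT.
have Pl : P g l by apply/asboolP; rewrite kp_ts.
set w := src g.
have sag a : a \in U -> src (comp a g) = w by move=> aU; rewrite src_comp// ag.
pose y := t (comp l g) ** x.
have My : M y by exact: ML.
have wy : p w ** y = y by rewrite numulA -(sag l lU) (kpf2_pt F).
pose z := y ** (s m ** s g).
have ez : z = t (comp l g) ** (\sum_(a <- U) c a *: s (comp a g)).
  by rewrite /z /y -(sum_mul_s c ag) -e !numulA.
pose J := [set b ** (s m ** s g) | b in M].
have Jz : J z by exists y.
have Jmin : z <> 0 -> minimal_left_ideal J.
  case: (minimal_mulr (s m ** s g) Mmin) => [h []|h _]; last exact: h.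
  exact: (h y My).
have [alone|] := pselect (forall a, a \in U -> a <> l -> ~~ P g a).
  have zc : z = c l *: p w.
    rewrite ez (t_mul_sum c (g := fun a => comp a g))// ?(sag l lU)// => a aU al.
    by have /asboolPn/contrapT := alone a aU al.
  have z0 : z <> 0.
    rewrite zc => /eqP; rewrite scaler_eq0 (negbTE cl) => /eqP.
    exact: p_neq0.
  have {}Jmin := Jmin z0; have Jl := minimal_ideal Jmin.
  have Jw : J (p w).
    have -> : p w = (c l)^-1 *: z by rewrite zc scalerA mulVf// scale1r.
    exact: subspaceZ Jl.1 _ _ Jz.
  exists w, y; split=> //; last by move=> y0; apply: z0; rewrite /z y0 numul0l.
  apply: minimal_line_vtx; suff -> : left_mul_ideal (p w) = J by [].
  apply/seteqP; split; first exact: left_mul_sub.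
  apply: (minimal_le Jmin (left_ideal_left_mul (p w)) (left_mul_sub Jl Jw)).
    exact: left_mul_self.
  exact: p_neq0.
move=> /existsNP[b /not_implyP[bU /not_implyP[bl /negP/negPn Pb]]]; exfalso.
have degP a : a \in U -> P g a -> deg a = deg l -> a = l.
  move=> aU /asboolP Pa dal; apply: contrapT => al; apply: Pa.
  apply: kp_ts0; first by rewrite !deg_comp ?ag// dal.
  by move=> /comp_inj[|||/esym]//; rewrite ag.
have [B Binj] := wdeg_separates [seq deg a | a <- U].
have {}Binj a : a \in U -> P g a -> wdeg B (deg a) = wdeg B (deg l) -> a = l.
  by move=> aU Pa /Binj h; apply: degP => //; apply: h; apply: map_f.
have [q qi qw] := infpath_ex L_ns w.
have srcq a : a \in U -> src (comp a g) = rng (q 0) by move=> /sag ->.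
have same a : a \in U -> P g a -> icat (comp l g) q = icat (comp a g) q.
  move=> aU Pa; apply: icat_common; rewrite ?srcq// => n.
  have rq : src g = rng (q n) by rewrite inf_rng.
  have /asboolP := Pstable a (q n) aU (esym rq) Pa.
  by rewrite !Defs.compA ?(ag _ lU) ?(ag _ aU).
(* The scalar by which [z] acts on [q]. *)
pose f := \sum_(a <- U | P g a)
  tofrac (c a)%:P * (twist K B (deg a) / twist K B (deg l)).
have Vq a : a \in U -> P g a ->
    act B (t (comp l g) ** s (comp a g)) (delta K q) =
    fun y => twist K B (deg a) / twist K B (deg l) * delta K q y.
  move=> aU Pa; rewrite act_ts_delta ?srcq//; last exact: same.
  apply/funext=> ?; rewrite !deg_comp ?ag// !twistD invfM mulrACA mulfV ?mulr1//.
  exact: twist_neq0.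
have zq : act B z (delta K q) = fun y => f * delta K q y.
  apply/funext=> y1; rewrite ez numul_sumr act_sum// /f mulr_suml.
  rewrite [RHS]big_mkcond [LHS]big_seq [RHS]big_seq; apply: eq_bigr => a aU.
  rewrite numulZr actZ//; case: ifP => Pa; first by rewrite Vq// mulrA.
  have -> : t (comp l g) ** s (comp a g) = 0.
    by move/negbT/asboolPn/contrapT: Pa.
  by rewrite act0// mulr0.
have f0 : f != 0.
  (* Weights separate the surviving degrees, so [c l] is a coefficient. *)
  pose R := \sum_(a <- U | P g a) c a *: 'X^(wdeg B (deg a)).
  have fR : f * twist K B (deg l) = tofrac R.
    rewrite /f mulr_suml /R (big_morph _ (@tofracD _) (@tofrac0 _)).
    apply: eq_bigr => a _.
    by rewrite -mulrA divfK ?twist_neq0// -mul_polyC tofracM tofracXn.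
  have Rl : R`_(wdeg B (deg l)) = c l.
    rewrite /R coef_sum big_mkcond (bigD1_seq l)//= Pl coefZ coefXn eqxx mulr1.
    rewrite big_seq_cond big1 ?addr0// => a /andP[aU al]; case: ifP => // Pa.
    rewrite coefZ coefXn; case: eqP => [/esym/(Binj _ aU Pa) e1|_].
      by rewrite e1 eqxx in al.
    by rewrite mulr0.
  apply/eqP => f0; move/eqP: fR; rewrite f0 mul0r eq_sym tofrac_eq0 => /eqP R0.
  by move: cl; rewrite -Rl R0 coef0 eqxx.
have z0 : z <> 0.
  move=> z0; have := congr1 (fun h => h q) zq; rewrite /= z0 act0// /delta.
  by case: pselect => //= _ /esym/eqP; rewrite mulr1 (negbTE f0).
apply: (@minimal_no_monomial B J z (t (comp l g) ** s (comp b g)) q f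
  (deg b) (deg l) (Jmin z0)) => //; first exact: Vq.
by move/(Binj _ bU Pb).
Qed.

(** * The socle *)

Lemma line_vtx_socle v : line_vtx v -> socle (KP L K) (p v).
Proof.
move=> lv; apply: (minimal_socle (line_vtx_minimal lv)).
exact: left_mul_self.
Qed.

Lemma socle_aperiodic : socle (KP L K) = ideal_gen (p @` aperiodic_vtx L).
Proof.
have [[S SL] SR] := socle_ideal (KP L K).
have [[I IL] IR] := ideal_gen_ideal (p @` aperiodic_vtx L).
apply/seteqP; split.
  move=> _ [r [hr ->]]; rewrite big_seq; elim/big_ind: _ => //.
  - exact: subspace0.
  - exact: subspaceD.
  move=> x /hr[M Mmin Mx].
  have [u [y [lu My y0 uy]]] := minimal_left_ideal_line Mmin.
  have [[MS ML] _ _] := Mmin.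
  have : M `<=` M `&` ideal_gen (p @` aperiodic_vtx L).
    apply: (minimal_le Mmin _ _ _ y0).
    - split; first split.
      + by split; [exact: (subspace0 MS)|exact: (subspace0 I)].
      + move=> a b [? ?] [? ?].
        by split; [exact: (subspaceD MS)|exact: (subspaceD I)].
      + move=> a b [? ?].
        by split; [exact: (subspaceZ MS)|exact: (subspaceZ I)].
      by move=> a b [? ?]; split; [exact: ML|exact: IL].
    - by move=> ? [].
    split=> //; rewrite -uy; apply: IR; apply: sub_ideal_gen; exists u => //.
    exact: line_vtx_aperiodic.
  by move=> /(_ _ Mx)[].
move=> x; apply; split; first exact: socle_ideal.
move=> _ [v /aperiodic_vtxP-/(_ L_rf L_ns)[n hn] <-].
rewrite (kpf4 F v n) -/(pathl _ _) big_seq; elim/big_ind: _ => //.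
- exact: subspace0.
- exact: subspaceD.
move=> l /pathlP[]// rl dl; rewrite -(kpf2_sp F); apply: (SR); apply: SL.
exact/line_vtx_socle/hn.
Qed.

(** Every element of the socle is a combination of products [s l ** t m] whose
    common source is a line vertex. *)
Lemma socle_spanned : socle (KP L K) `<=` spanned (@line_vtx k L).
Proof.
have Ih := spanned_ideal K L_rf (@line_vtx_hereditary k L).
rewrite socle_aperiodic => x; apply; split=> // _ [v hv <-].
have [n hn] := (aperiodic_vtxP L_rf L_ns v).1 hv.
have [[I _] _] := Ih.
rewrite (kpf4 F v n) -/(pathl _ _) big_seq; elim/big_ind: _ => //.
- exact: subspace0.
- exact: subspaceD.
by move=> l /pathlP[]// rl dl; apply: spanned_gen => //; exact: hn.
Qed.

Lemma socle_essentialP : essential_ideal (socle (KP L K)) <->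
  forall v, exists l, rng l = v /\ line_vtx (src l).
Proof.
have Sid := socle_ideal (KP L K); have [[S SL] SR] := Sid.
split=> [[_ ess] v|h].
  pose J := ideal_gen [set p v].
  have Jid : ideal J by exact: ideal_gen_ideal.
  have Jv : J (p v) by exact: sub_ideal_gen.
  have J0 : J <> [set 0] by move=> e; move: Jv; rewrite e; exact: p_neq0.
  have [||x [Sx Jx] x0] := @set_neq0P _ _ (socle (KP L K) `&` J).
  - by split; [exact: subspace0|exact: subspace0 Jid.1.1].
  - exact: ess.
  have [m [U [c [_ [lm _ _ _ [xm0 _]]]]]] :=
    kp_reduction L_rf (@line_vtx_hereditary k L) (socle_spanned Sx) x0.
  have [y vy] : exists y, p v ** y ** p (src m) <> 0.
    apply/existsNP => h; apply: xm0.
    (* [Q] is an ideal that contains [p v]. *)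
    pose Q := [set z | forall y, z ** y ** p (src m) = 0].
    have : Q x.
      apply: Jx; split; last by move=> _ ->.
      split; first split; first split.
      + by move=> y; rewrite !numul0l.
      + by move=> a b ha hb y; rewrite !numulDl ha hb addr0.
      + by move=> a b hb y; rewrite !numulZl hb scaler0.
      + by move=> a b hb y; rewrite -!numulA [b ** _]numulA hb numul0r.
      by move=> a b hb y; rewrite -[b ** a ** y]numulA hb.
    by move=> /(_ (s m)); rewrite -numulA (kpf2_sp F).
  apply: contrapT => nl; apply: vy; move: y (spannedT L_rf y).
  apply: spanned_ind; first split.
  - by rewrite numul0r numul0l.
  - by move=> y y' e e'; rewrite numulDr numulDl e e' addr0.
  - by move=> a y e; rewrite numulZr numulZl e scaler0.
  move=> l m' lm' _; have [rl|rl] := pselect (v = rng l); last first.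
    by rewrite numulA kp_p_mul_neq// !numul0l.
  have [rm|rm] := pselect (rng m' = src m); last first.
    rewrite -(kpf2_tp F m') -!numulA (kpf1 F); case: eqP => // _.
    by rewrite !numul0r.
  case: nl; exists l; split=> //; rewrite lm'.
  by apply: line_vtx_hereditary; rewrite rm.
split=> // J Jid J0; have [[JS JL] JR] := Jid.
have [x Jx x0] := set_neq0P (subspace0 JS) J0.
have [m [U [c [l [_ Uu Us [lU cl] [xm0 e]]]]]] :=
  kp_reduction L_rf setT_h (spannedT L_rf x) x0.
have [g [rg lg]] := h (src m).
have ag a : a \in U -> src a = rng g by move=> /Us ->.
have e1 : t (comp l g) ** (x ** s m ** s g) = c l *: p (src g).
  rewrite e (sum_mul_s c ag) (t_mul_sum c (g := fun a => comp a g))//.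
    by rewrite src_comp// ag.
  move=> a aU al; have [la aa] := (ag l lU, ag a aU).
  apply: kp_ts_line; rewrite ?(src_comp la) ?(src_comp aa)// => e2; apply: al.
  have dla : deg l = deg a.
    apply: (@rvn_addI _ (deg g)).
    by rewrite ![deg g + _]addrC -(deg_comp la) -(deg_comp aa) e2.
  by have [||| ->] := comp_inj _ _ _ e2.
move=> e2; have : (socle (KP L K) `&` J) (p (src g)).
  split; first exact: line_vtx_socle.
  have -> : p (src g) = (c l)^-1 *: (t (comp l g) ** (x ** s m ** s g)).
    by rewrite e1 scalerA mulVf// scale1r.
  by apply: subspaceZ => //; exact/JL/JR/JR.
by rewrite e2; exact: p_neq0.
Qed.

End Socle.

Theorem proposition5p12 (k : nat) (k_gt0 : (0 < k)%N) (L : kgraph k)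
    (K : fieldType) (L_rf : row_finite L) (L_ns : no_sources L) :
  [/\ (forall v : vtx L,
         minimal_left_ideal (left_mul_ideal (kp_p K v)) <->
         aperiodic_atom (tal_gen L v 0)),
      [/\ hereditary (aperiodic_vtx L),
          saturated (aperiodic_vtx L)
        & socle (KP L K) = ideal_gen (kp_p K @` aperiodic_vtx L)]
    & (essential_ideal (socle (KP L K)) <->
       forall v : vtx L, exists (w : vtx L) (m : 'rV[nat]_k),
         alg_le (tal_gen L w (map_mx Posz m)) (tal_gen L v 0) /\
         aperiodic_atom (tal_gen L w (map_mx Posz m)))].
Proof.
split.
- move=> v; rewrite (aperiodic_atomP L_rf L_ns).
  by split=> [/(minimal_line_vtx L_rf L_ns)|/(line_vtx_minimal K L_rf L_ns)].
- split; first exact: aperiodic_vtx_hereditary.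
    exact: aperiodic_vtx_saturated.
  exact: socle_aperiodic.
rewrite (socle_essentialP K L_rf L_ns); split=> h v.
  have [l [rl ll]] := h v; exists (src l), (deg l).
  rewrite (aperiodic_atomP L_rf L_ns); split=> //.
  by have := tal_gen_le_path L_rf L_ns 0 rl; rewrite add0r.
have [w [m [le_wv]]] := h v; rewrite (aperiodic_atomP L_rf L_ns) => lw.
exact: le_gen_line_vtx le_wv.
Qed.
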